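(* Let $A$ be a unital Banach algebra and let $a\in A$ satisfy $\mathrm{Sp}(a)\cap i\mathbb{R}=\emptyset$. Let $S=\mathrm{sign}(a)$. Then: (1) $S^2=1$. (2) $S\in\{a\}''$. (3) If $a$ is also a selfadjoint Hilbert space operator then $S$ is a symmetry (that is, a selfadjoint unitary). More generally, for $a$ a Hilbert space operator, $\mathrm{sign}(a^* )=\mathrm{sign}(a)^*$. (4) $E_+=\frac12(1+S)$ and $E_-=\frac12(1-S)$ are idempotents with sum $1$, and $SE_+=E_+$, $SE_-=-E_-$, $S=E_+-E_-$. Moreover $E_+$ is the spectral idempotent of $a$ associated with $\mathrm{Sp}(a)\cap\mathbb{H}$. (5) $\mathrm{Sp}(a)\subset\mathbb{H}$ if and only if $\mathrm{sign}(a)=1$. (6) $\mathrm{sign}(v^{-1}av)=v^{-1}\,\mathrm{sign}(a)\,v$ for every invertible $v\in A$. (7) $a=\mathrm{sign}(a)\,N$ where $N=(a^2)^{1/2}$. (8) $\mathrm{sign}(ca)=\mathrm{sign}(c)\,\mathrm{sign}(a)$ for every nonzero real scalar $c$. (9) $\mathrm{sign}(a^{-1})=\mathrm{sign}(a)$.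
   Context: Algebras are complex; a unital Banach algebra has an identity of norm $1$. $\mathbb{H}$ is the open right half plane, $\mathrm{Sp}$ denotes spectrum, and $\{a\}''$ is the second commutant of $a$ in $A$. If $x\in A$ has spectrum disjoint from $(-\infty,0]$, then $x^{1/2}$ denotes the principal square root of $x$: the unique square root of $x$ with spectrum in $\mathbb{H}$; and $x^{-1/2}=(x^{1/2})^{-1}$. If $\mathrm{Sp}(a)\cap i\mathbb{R}=\emptyset$ then $\mathrm{Sp}(a^2)$ is disjoint from $(-\infty,0]$, and one defines $\mathrm{sign}(a)=a\,(a^2)^{-1/2}$ (applied also to scalars, so $\mathrm{sign}(c)=\pm1$ for nonzero real $c$). The spectral idempotent of $a$ associated with $\mathrm{Sp}(a)\cap\mathbb{H}$ (a relatively open and closed subset of the spectrum) is the Riesz idempotent $\frac{1}{2\pi i}\int_\Gamma (z1-a)^{-1}\,dz$, with $\Gamma$ a contour in $\mathbb{H}$ enclosing $\mathrm{Sp}(a)\cap\mathbb{H}$ once counterclockwise. In (3), a Hilbert space operator means the case that $A$ is the algebra of bounded operators on a complex Hilbert space. *)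

(* Defs.v *)
From HB Require Import structures.
From mathcomp Require Import all_boot all_order all_algebra.
From mathcomp Require Import complex.
From mathcomp Require Import all_classical all_reals all_analysis.

Set Implicit Arguments.
Unset Strict Implicit.
Unset Printing Implicit Defensive.

Import Order.TTheory GRing.Theory Num.Theory.
Import numFieldNormedType.Exports.

Local Open Scope classical_set_scope.
Local Open Scope ring_scope.
Local Open Scope complex_scope.

(* The norm is an explicit real-valued operation rather than the one inherited
   from normedModType R[i]: HB accepts no structure joining rings and normed
   modules other than the existing numDomainType hierarchy.  Over a classical
   metatheory unitAlgType is no restriction on a nontrivial algebra, and
   nontriviality follows from bnorm1. *)
HB.mixin Record isBanachAlgebra (R : realType) A & GRing.UnitAlgebra R[i] A := {
  bnorm : A -> R ;
  bnorm0_eq0 : forall x, bnorm x = 0 -> x = 0 ;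
  bnormD : forall x y, bnorm (x + y) <= bnorm x + bnorm y ;
  bnormZ : forall (k : R[i]) x, bnorm (k *: x) = Normc.normc k * bnorm x ;
  bnormM : forall x y, bnorm (x * y) <= bnorm x * bnorm y ;
  bnorm1 : bnorm 1 = 1 ;
  bnorm_complete : forall u : nat -> A,
    (forall e : R, 0 < e -> exists N : nat, forall m n : nat,
       (N <= m)%N -> (N <= n)%N -> bnorm (u m - u n) < e) ->
    exists l : A, forall e : R, 0 < e -> exists N : nat, forall n : nat,
       (N <= n)%N -> bnorm (u n - l) < e }.

#[short(type="banachAlgType")]
HB.structure Definition BanachAlgebra (R : realType) :=
  {A of GRing.UnitAlgebra R[i] A & isBanachAlgebra R A}.

(* Nonzero complex Hilbert spaces; the zero space is excluded because its
   algebra of operators has no identity of norm 1. *)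
HB.mixin Record isHilbert (R : realType) H & CompleteNormedModule R[i] H := {
  inner : H -> H -> R[i] ;
  innerDl : forall x y z, inner (x + y) z = inner x z + inner y z ;
  innerZl : forall (k : R[i]) x y, inner (k *: x) y = k * inner x y ;
  innerC : forall x y, inner y x = (inner x y)^* ;
  inner_norm : forall x, inner x x = `|x| ^+ 2 ;
  hilbert_neq0 : exists x : H, x != 0 }.

#[short(type="hilbertType")]
HB.structure Definition Hilbert (R : realType) :=
  {H of CompleteNormedModule R[i] H & isHilbert R H}.

Lemma cauchy_seq_cvg (K : numFieldType) (V : completeNormedModType K)
    (u : nat -> V) :
  (forall e : K, 0 < e -> exists N : nat, forall m n : nat,
     (N <= m)%N -> (N <= n)%N -> `|u m - u n| < e) ->
  exists l : V, forall e : K, 0 < e -> exists N : nat, forall n : nat,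
     (N <= n)%N -> `|u n - l| < e.
Proof.
move=> uC.
have : cauchy (u @ \oo).
  apply: cauchy_exP => e e0; have [N uN] := uC _ e0.
  by exists (u N); exists N => // n /= Nn; rewrite -ball_normE /=; exact: uN.
move=> /cauchy_cvg /cvg_ex[l ul]; exists l => e e0.
have /cvgrPdist_lt/(_ _ e0)[N _ uN] := ul.
by exists N => n Nn; rewrite distrC; exact: uN.
Qed.

Section complex_banach.
Variable R : realType.
Local Notation C := (R[i]^o).

Lemma normc_ge_Re (x : R[i]) : `|complex.Re x| <= Normc.normc x.
Proof.
by case: x => a b /=; rewrite -sqrtr_sqr ler_wsqrtr // lerDl sqr_ge0.
Qed.

Lemma normc_ge_Im (x : R[i]) : `|complex.Im x| <= Normc.normc x.
Proof.
by case: x => a b /=; rewrite -sqrtr_sqr ler_wsqrtr // lerDr sqr_ge0.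
Qed.

Lemma normc_le_ReIm (x : R[i]) :
  Normc.normc x <= `|complex.Re x| + `|complex.Im x|.
Proof.
case: x => a b /=; rewrite -[leRHS]ger0_norm ?addr_ge0 // -sqrtr_sqr.
rewrite ler_wsqrtr // sqrrD !real_normK ?num_real // -addrA lerD2l lerDr.
by rewrite mulrn_wge0 // mulr_ge0.
Qed.

Lemma complex_seq_complete (u : nat -> C) :
  (forall e : R, 0 < e -> exists N : nat, forall m n : nat,
     (N <= m)%N -> (N <= n)%N -> Normc.normc (u m - u n) < e) ->
  exists l : C, forall e : R, 0 < e -> exists N : nat, forall n : nat,
     (N <= n)%N -> Normc.normc (u n - l) < e.
Proof.
move=> uC.
have [|a ua] := @cauchy_seq_cvg R R^o (fun n => complex.Re (u n)).
  move=> e /uC[N uN]; exists N => m n Nm Nn.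
  apply: le_lt_trans (uN _ _ Nm Nn).
  by have := normc_ge_Re (u m - u n); case: (u m) (u n) => ? ? [].
have [|b ub] := @cauchy_seq_cvg R R^o (fun n => complex.Im (u n)).
  move=> e /uC[N uN]; exists N => m n Nm Nn.
  apply: le_lt_trans (uN _ _ Nm Nn).
  by have := normc_ge_Im (u m - u n); case: (u m) (u n) => ? ? [].
exists (a +i* b) => e e0; have e20 : 0 < e / 2 by rewrite divr_gt0.
have [N uN] := ua _ e20; have [M uM] := ub _ e20.
exists (maxn N M) => n; rewrite geq_max => /andP[Nn Mn].
apply: le_lt_trans (normc_le_ReIm _) _; rewrite [ltRHS](splitr e).
have := uN _ Nn; have := uM _ Mn.
by case: (u n) => x y /= h1 h2; apply: ltrD.
Qed.

Lemma complex_normM_le (x y : C) :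
  Normc.normc (x * y) <= Normc.normc x * Normc.normc y.
Proof. by rewrite Normc.normcM. Qed.

HB.instance Definition _ := isBanachAlgebra.Build R C
  (@Normc.eq0_normc R) (@le_normcD R) (@Normc.normcM R)
  complex_normM_le
  (@Normc.normc1 R) complex_seq_complete.

End complex_banach.

Section bounded_operators.
Variables (R : realType) (H : hilbertType R).

Definition bounded_op (T : H -> H) :=
  linear T /\ exists M : R, forall x, `|T x| <= M%:C * `|x|.

Record bop := Bop { bop_fun :> H -> H ; bopP : bounded_op bop_fun }.

Lemma bop_ext (S T : bop) : S =1 T -> S = T.
Proof.
case: S T => [S SP] [T TP] /= /funext ST; case: T / ST TP => TP.
by rewrite (Prop_irrelevance SP TP).
Qed.

HB.instance Definition _ := gen_eqMixin bop.
HB.instance Definition _ := gen_choiceMixin bop.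

Let hn (x : H) : R := complex.Re `|x|.

Let hnE x : `|x| = (hn x)%:C.
Proof. by rewrite /hn RRe_real // ger0_real. Qed.

Let hn_ge0 x : 0 <= hn x.
Proof. by rewrite -lecR -hnE; exact: normr_ge0. Qed.

Let hnD x y : hn (x + y) <= hn x + hn y.
Proof. by rewrite -lecR rmorphD /= -!hnE ler_normD. Qed.

Let hnZ k x : hn (k *: x) = Normc.normc k * hn x.
Proof. by apply: (@complexI R); rewrite rmorphM /= -!hnE normrZ. Qed.

Let hn0_eq0 x : hn x = 0 -> x = 0.
Proof. by move=> x0; apply/eqP; rewrite -normr_eq0 hnE x0. Qed.

Let hn0 : hn 0 = 0.
Proof. by rewrite /hn normr0. Qed.

Let normcR (a : R) : Normc.normc a%:C = `|a|.
Proof. by rewrite /= expr0n addr0 sqrtr_sqr. Qed.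

Let boundedP (T : H -> H) : linear T ->
  (exists M : R, forall x, hn (T x) <= M * hn x) -> bounded_op T.
Proof.
move=> lT [M TM]; split => //; exists M => x.
by rewrite !hnE -rmorphM /= lecR.
Qed.

Let bop_bound (T : bop) : exists2 M : R, 0 <= M & forall x, hn (T x) <= M * hn x.
Proof.
have [_ [M TM]] := bopP T; exists `|M| => // x.
apply: (@le_trans _ _ (M * hn x)); last by rewrite ler_wpM2r // ler_norm.
by rewrite -lecR rmorphM /= -!hnE.
Qed.

Let bopL (T : bop) : linear T. Proof. by have [] := bopP T. Qed.

Let bopD (T : bop) x y : T (x + y) = T x + T y.
Proof. by have := bopL T 1 x y; rewrite !scale1r. Qed.

Let bop0 (T : bop) : T 0 = 0.
Proof. by apply: (addrI (T 0)); rewrite -bopD !addr0. Qed.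

Let bopZ (T : bop) k x : T (k *: x) = k *: T x.
Proof. by have := bopL T k x 0; rewrite !addr0 bop0 addr0. Qed.

Let bop_zero_subproof : bounded_op (fun _ => 0).
Proof.
apply: boundedP => [k x y|]; first by rewrite scaler0 addr0.
by exists 0 => x; rewrite hn0 mul0r.
Qed.
Definition bop_zero := Bop bop_zero_subproof.

Let bop_add_subproof (S T : bop) : bounded_op (fun x => S x + T x).
Proof.
apply: boundedP => [k x y|]; first by rewrite !bopL scalerDr addrACA.
have [M _ SM] := bop_bound S; have [N _ TN] := bop_bound T.
by exists (M + N) => x; rewrite (le_trans (hnD _ _)) // mulrDl lerD.
Qed.
Definition bop_add S T := Bop (bop_add_subproof S T).

Let bop_scale_subproof (k : R[i]) (T : bop) : bounded_op (fun x => k *: T x).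
Proof.
apply: boundedP => [l x y|]; first by rewrite bopL scalerDr !scalerA mulrC.
have [N _ TN] := bop_bound T; exists (Normc.normc k * N) => x.
rewrite hnZ -mulrA ler_wpM2l //.
exact: le_trans (normr_ge0 _) (normc_ge_Re k).
Qed.
Definition bop_scale k T := Bop (bop_scale_subproof k T).

Definition bop_opp T := bop_scale (-1) T.

Let bop_one_subproof : bounded_op id.
Proof. by apply: boundedP => [k x y //|]; exists 1 => x; rewrite mul1r. Qed.
Definition bop_one := Bop bop_one_subproof.

Let bop_mul_subproof (S T : bop) : bounded_op (S \o T).
Proof.
apply: boundedP => [k x y|]; first by rewrite /= !bopL.
have [M M0 SM] := bop_bound S; have [N _ TN] := bop_bound T.
exists (M * N) => x /=.
by rewrite (le_trans (SM _)) // -mulrA ler_wpM2l.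
Qed.
Definition bop_mul S T := Bop (bop_mul_subproof S T).

Let addA : associative bop_add.
Proof. by move=> S T U; apply: bop_ext => x /=; rewrite addrA. Qed.
Let addC : commutative bop_add.
Proof. by move=> S T; apply: bop_ext => x /=; rewrite addrC. Qed.
Let add0 : left_id bop_zero bop_add.
Proof. by move=> S; apply: bop_ext => x /=; rewrite add0r. Qed.
Let addN : left_inverse bop_zero bop_opp bop_add.
Proof. by move=> S; apply: bop_ext => x /=; rewrite scaleN1r addNr. Qed.

HB.instance Definition _ := GRing.isZmodule.Build bop addA addC add0 addN.

Let mulA : associative bop_mul.
Proof. by move=> S T U; apply: bop_ext. Qed.
Let mul1 : left_id bop_one bop_mul.
Proof. by move=> T; apply: bop_ext. Qed.
Let mul_1 : right_id bop_one bop_mul.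
Proof. by move=> T; apply: bop_ext. Qed.
Let mulDl : left_distributive bop_mul +%R.
Proof. by move=> S T U; apply: bop_ext. Qed.
Let mulDr : right_distributive bop_mul +%R.
Proof. by move=> S T U; apply: bop_ext => x /=; rewrite bopD. Qed.
Let one_neq0 : bop_one != 0.
Proof.
apply/eqP => e; have [x /eqP] := @hilbert_neq0 R H; apply.
exact: (congr1 (fun T : bop => T x) e).
Qed.

HB.instance Definition _ :=
  GRing.Zmodule_isNzRing.Build bop mulA mul1 mul_1 mulDl mulDr one_neq0.

Let scaleA a b (T : bop) : bop_scale a (bop_scale b T) = bop_scale (a * b) T.
Proof. by apply: bop_ext => x /=; rewrite scalerA. Qed.
Let scale1 : left_id 1 bop_scale.
Proof. by move=> T; apply: bop_ext => x /=; rewrite scale1r. Qed.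
Let scaleDr : right_distributive bop_scale +%R.
Proof. by move=> k S T; apply: bop_ext => x /=; rewrite scalerDr. Qed.
Let scaleDl (T : bop) : {morph bop_scale^~ T : a b / a + b}.
Proof. by move=> a b; apply: bop_ext => x /=; rewrite scalerDl. Qed.

HB.instance Definition _ :=
  GRing.Zmodule_isLmodule.Build R[i] bop scaleA scale1 scaleDr scaleDl.

Let scaleAl (k : R[i]) (S T : bop) : k *: (S * T) = (k *: S) * T.
Proof. by apply: bop_ext. Qed.
Let scaleAr (k : R[i]) (S T : bop) : k *: (S * T) = S * (k *: T).
Proof. by apply: bop_ext => x /=; rewrite bopZ. Qed.

HB.instance Definition _ := GRing.Lmodule_isLalgebra.Build R[i] bop scaleAl.
HB.instance Definition _ := GRing.Lalgebra_isAlgebra.Build R[i] bop scaleAr.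

Definition bop_invertible (T : bop) := exists S : bop, S * T = 1 /\ T * S = 1.

Definition bop_inv (T : bop) : bop :=
  if pselect (bop_invertible T) is left TV then sval (cid TV) else T.

Let bop_unit : pred bop := fun T => `[< bop_invertible T >].
Let mulV : {in bop_unit, left_inverse 1 bop_inv *%R}.
Proof.
move=> T /asboolP TV; rewrite /bop_inv; case: pselect => // {}TV.
by case: cid => S [].
Qed.
Let divV : {in bop_unit, right_inverse 1 bop_inv *%R}.
Proof.
move=> T /asboolP TV; rewrite /bop_inv; case: pselect => // {}TV.
by case: cid => S [].
Qed.
Let unitP (T S : bop) : S * T = 1 /\ T * S = 1 -> bop_unit T.
Proof. by move=> TS; apply/asboolP; exists S. Qed.
Let inv_out : {in [predC bop_unit], bop_inv =1 id}.
Proof. by move=> T /asboolP TV; rewrite /bop_inv; case: pselect. Qed.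

HB.instance Definition _ :=
  GRing.NzRing_hasMulInverse.Build bop mulV divV unitP inv_out.

Definition opnorm (T : bop) : R :=
  sup [set complex.Re `|T x| | x in [set x : H | `|x| <= 1]].

Let opnorm_has_sup (T : bop) :
  has_sup [set complex.Re `|T x| | x in [set x : H | `|x| <= 1]].
Proof.
split; first by exists (hn (T 0)); exists 0 => //=; rewrite normr0.
have [M M0 TM] := bop_bound T; exists M => _ [x /= x1 <-].
by rewrite (le_trans (TM x)) // ler_piMr // -lecR -hnE.
Qed.

Let opnorm_ge0 T : 0 <= opnorm T.
Proof.
apply: (ub_le_sup (opnorm_has_sup T).2).
by exists 0; rewrite /= ?normr0 // bop0 normr0.
Qed.

Let opnormP (T : bop) x : hn (T x) <= opnorm T * hn x.
Proof.
have [->|x0] := eqVneq x 0; first by rewrite bop0 hn0 mulr0.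
have hx0 : 0 < hn x.
  by rewrite lt_neqAle hn_ge0 andbT eq_sym; apply/eqP => /hn0_eq0/eqP; apply/negP.
rewrite -ler_pdivrMr //; apply: (ub_le_sup (opnorm_has_sup T).2).
exists ((hn x)^-1%:C *: x) => /=.
  by rewrite hnE hnZ normcR ger0_norm ?invr_ge0 // mulVf // gt_eqF.
by rewrite bopZ -/(hn _) hnZ normcR ger0_norm ?invr_ge0 // mulrC.
Qed.

Let opnorm_le (T : bop) M : 0 <= M -> (forall x, hn (T x) <= M * hn x) ->
  opnorm T <= M.
Proof.
move=> M0 TM; apply: ge_sup; first exact: (opnorm_has_sup T).1.
move=> _ [x /= x1 <-].
by rewrite (le_trans (TM x)) // ler_piMr // -lecR -hnE.
Qed.

Let opnorm0_eq0 (T : bop) : opnorm T = 0 -> T = 0.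
Proof.
move=> T0; apply: bop_ext => x; apply: hn0_eq0; apply/le_anti.
by rewrite hn_ge0 andbT; have := opnormP T x; rewrite T0 mul0r.
Qed.

Let opnormD (S T : bop) : opnorm (S + T) <= opnorm S + opnorm T.
Proof.
apply: opnorm_le => [|x]; first by rewrite addr_ge0.
by rewrite (le_trans (hnD _ _)) // mulrDl lerD.
Qed.

Let opnormZ_le (k : R[i]) (T : bop) : opnorm (k *: T) <= Normc.normc k * opnorm T.
Proof.
have k0 : 0 <= Normc.normc k := le_trans (normr_ge0 _) (normc_ge_Re k).
apply: opnorm_le => [|x]; first by rewrite mulr_ge0.
by rewrite hnZ -mulrA ler_wpM2l.
Qed.

Let opnormZ (k : R[i]) (T : bop) : opnorm (k *: T) = Normc.normc k * opnorm T.
Proof.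
have [->|k0] := eqVneq k 0.
  by apply/le_anti; rewrite opnormZ_le scale0r Normc.normc0 mul0r opnorm_ge0.
have kgt0 : 0 < Normc.normc k.
  rewrite lt_neqAle (le_trans (normr_ge0 _) (normc_ge_Re k)) andbT eq_sym.
  by apply: contra k0 => /eqP/Normc.eq0_normc ->.
apply/le_anti; rewrite opnormZ_le andTb mulrC -ler_pdivlMr //.
have {1}-> : T = k^-1 *: (k *: T) by rewrite scalerA mulVf // scale1r.
by rewrite (le_trans (opnormZ_le _ _)) // Normc.normcV mulrC.
Qed.

Let opnormM (S T : bop) : opnorm (S * T) <= opnorm S * opnorm T.
Proof.
apply: opnorm_le => [|x]; first by rewrite mulr_ge0.
by rewrite (le_trans (opnormP S _)) // -mulrA ler_wpM2l.
Qed.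

Let opnorm1 : opnorm 1 = 1.
Proof.
apply/le_anti/andP; split; first by apply: opnorm_le => // x; rewrite mul1r.
have [x x0] := @hilbert_neq0 R H.
have hx0 : 0 < hn x.
  by rewrite lt_neqAle hn_ge0 andbT eq_sym; apply/eqP => /hn0_eq0/eqP; apply/negP.
by rewrite -(ler_pM2r hx0) mul1r; exact: (opnormP bop_one x).
Qed.

Let opnorm_complete (u : nat -> bop) :
  (forall e : R, 0 < e -> exists N : nat, forall m n : nat,
     (N <= m)%N -> (N <= n)%N -> opnorm (u m - u n) < e) ->
  exists l : bop, forall e : R, 0 < e -> exists N : nat, forall n : nat,
     (N <= n)%N -> opnorm (u n - l) < e.
Proof.
move=> uC.
have subE (S T : bop) x : bop_fun (S - T) x = S x - T x by rewrite /= scaleN1r.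
have ux x : exists l : H, forall e : R, 0 < e -> exists N : nat,
    forall n : nat, (N <= n)%N -> hn (u n x - l) < e.
  have [|l ul] := @cauchy_seq_cvg _ H (fun n => u n x).
    move=> e e0; have eE : e = (complex.Re e)%:C by rewrite RRe_real // gtr0_real.
    have re0 : 0 < complex.Re e by rewrite -ltcR -eE.
    have hx1 : 0 < hn x + 1 by rewrite ltr_wpDl.
    have [N uN] := uC _ (divr_gt0 re0 hx1); exists N => m n Nm Nn.
    rewrite hnE eE ltcR -subE (le_lt_trans (opnormP _ _)) //.
    rewrite (@le_lt_trans _ _ (opnorm (u m - u n) * (hn x + 1))) //.
      by rewrite ler_wpM2l // lerDl.
    by rewrite -ltr_pdivlMr // uN.
  exists l => e e0; have e0' : 0 < e%:C by rewrite ltcR.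
  by have [N uN] := ul _ e0'; exists N => n /uN; rewrite hnE ltcR.
pose l x := sval (cid (ux x)).
have lP x : forall e : R, 0 < e -> exists N : nat,
    forall n : nat, (N <= n)%N -> hn (u n x - l x) < e by rewrite /l; case: cid.
have ul e : 0 < e -> exists N : nat, forall n x, (N <= n)%N ->
    hn (u n x - l x) <= e * hn x.
  move=> e0; have [N uN] := uC _ e0; exists N => n x Nn.
  apply/ler_addgt0Pr => d d0; have [M uM] := lP x _ d0.
  have -> : u n x - l x =
      bop_fun (u n - u (maxn N M)) x + (u (maxn N M) x - l x) by rewrite subE addrA subrK.
  rewrite (le_trans (hnD _ _)) // lerD //; last by rewrite ltW // uM // leq_maxr.
  rewrite (le_trans (opnormP _ _)) // ler_wpM2r // ltW // uN //.
  exact: leq_maxl.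
have hn_small x : (forall e, 0 < e -> hn x <= e) -> x = 0.
  move=> xe; apply: hn0_eq0; apply/le_anti; rewrite hn_ge0 andbT.
  by apply/ler_addgt0Pr => e e0; rewrite add0r xe.
have lL : linear l.
  move=> k x y; apply/eqP; rewrite -subr_eq0; apply/eqP.
  set z := k *: x + y; set w := (X in X = 0).
  have k1 : 0 < Normc.normc k * hn x + hn y + hn z + 1.
    by rewrite ltr_wpDl // !addr_ge0 // mulr_ge0 //
       (le_trans (normr_ge0 _) (normc_ge_Re k)).
  apply: hn_small => e e0; have [N uN] := ul _ (divr_gt0 e0 k1).
  have -> : w = k *: (u N x - l x) + (u N y - l y) + (-1) *: (u N z - l z).
    rewrite /w /z (bopL (u N)) scaleN1r opprB scalerBr.
    by rewrite (addrACA (k *: u N x)) -opprD [RHS]addrC addrA subrK.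
  rewrite (le_trans (hnD _ _)) // (le_trans (lerD (hnD _ _) (lexx _))) //.
  rewrite !hnZ normcN Normc.normc1 mul1r.
  have h1 := uN N x (leqnn _); have h2 := uN N y (leqnn _).
  have h3 := uN N z (leqnn _); set d := e / _ in h1 h2 h3.
  apply: (@le_trans _ _ (d * (Normc.normc k * hn x + hn y + hn z + 1))).
    rewrite !mulrDr mulr1 -[leLHS]addr0 !lerD //.
      by rewrite mulrCA ler_wpM2l // (le_trans (normr_ge0 _) (normc_ge_Re k)).
    by rewrite divr_ge0 // ltW.
  by rewrite divfK // gt_eqF.
have lB : bounded_op l.
  apply: boundedP => //; have [N uN] := ul _ ltr01.
  exists (opnorm (u N) + 1) => x.
  have -> : l x = u N x + (-1) *: (u N x - l x) by rewrite scaleN1r opprB addrCA subrr addr0.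
  rewrite (le_trans (hnD _ _)) // mulrDl lerD //.
  by rewrite hnZ normcN Normc.normc1 !mul1r; have := uN N x (leqnn N); rewrite mul1r.
exists (Bop lB) => e e0; have e20 : 0 < e / 2 by rewrite divr_gt0.
have [N uN] := ul _ e20; exists N => n Nn.
apply: (@le_lt_trans _ _ (e / 2)); last by rewrite ltr_pdivrMr // mulr_natr mulr2n ltrDl.
by apply: opnorm_le => [|x]; [exact: ltW | rewrite subE uN].
Qed.

HB.instance Definition _ := isBanachAlgebra.Build R bop
  opnorm0_eq0 opnormD opnormZ opnormM opnorm1 opnorm_complete.

(* An operator satisfying the condition exists and is unique by the Riesz
   representation theorem. *)
Definition adjoint (T : bop) : bop :=
  xget 0 [set S : bop | forall x y, inner (T x) y = inner x (S y)].

Definition selfadjoint (T : bop) := adjoint T = T.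

Definition unitary (T : bop) := adjoint T * T = 1 /\ T * adjoint T = 1.

Definition symmetry (T : bop) := selfadjoint T /\ unitary T.

End bounded_operators.

Section sign.
Variables (R : realType) (A : unitAlgType R[i]).

Definition spectrum (a : A) : set R[i] :=
  [set z | z%:A - a \isn't a GRing.unit].

Definition right_half_plane : set R[i] := [set z | 0 < complex.Re z].

Definition imaginary_axis : set R[i] := [set z | complex.Re z = 0].

Definition commutant (X : set A) : set A :=
  [set b | forall x, X x -> b * x = x * b].

Definition bicommutant (a : A) : set A := commutant (commutant [set a]).

(* The unique square root with spectrum in the right half plane; 0 when there is
   none. *)
Definition principal_sqrt (x : A) : A :=
  xget 0 [set y | y * y = x /\ spectrum y `<=` right_half_plane].

Definition sign (a : A) : A := a * (principal_sqrt (a ^+ 2))^-1.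

End sign.

Arguments right_half_plane {R}.
Arguments imaginary_axis {R}.

Section contour_integral.
Variables (R : realType).
Implicit Types (g : R -> R[i]) (G : seq (seq (R -> R[i]))).

(* Norm limit of Riemann sums over tagged partitions of [a, b]. *)
Definition has_Rint (A : banachAlgType R) (f : R -> A) (a b : R) (I : A) :=
  forall e : R, 0 < e -> exists2 d : R, 0 < d &
    forall (n : nat) (t s : nat -> R), t 0%N = a -> t n = b ->
      (forall i, (i < n)%N -> t i <= s i <= t i.+1 /\ t i.+1 - t i < d) ->
      bnorm (\sum_(i < n) (t i.+1 - t i)%:C *: f (s i) - I) < e.

(* C^1 arcs parametrized by [0, 1].  Arcs are total functions; a function that
   is C^1 on [0, 1] with one-sided derivatives at the endpoints extends to one
   with two-sided derivatives there. *)
Definition C1_01 (f : R -> R) :=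
  {in `[0, 1], forall t, derivable f t 1} /\
  {within `[0, 1], continuous (derive1 f)}.

Definition C1_arc g :=
  C1_01 (fun t => complex.Re (g t)) /\ C1_01 (fun t => complex.Im (g t)).

Definition velocity g (t : R) : R[i] :=
  derive1 (fun t => complex.Re (g t)) t +i* derive1 (fun t => complex.Im (g t)) t.

(* A contour is a finite family of closed piecewise C^1 curves, each one a
   cyclic sequence of C^1 arcs. *)
Definition contour_in G (D : set R[i]) :=
  forall p, p \in G ->
    cycle (fun g h => g 1 == h 0) p /\
    forall g, g \in p -> C1_arc g /\ {in `[0, 1], forall t, D (g t)}.

Definition has_cint (A : banachAlgType R) G (f : R[i] -> A) (I : A) :=
  exists J : (R -> R[i]) -> A,
    (forall g, g \in flatten G ->
       has_Rint (fun t => velocity g t *: f (g t)) 0 1 (J g)) /\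
    I = \sum_(g <- flatten G) J g.

Definition two_pi_i : R[i] := 0 +i* (2 * pi).

(* Winding number 1 about w, i.e. w is enclosed once counterclockwise. *)
Definition winds_once G (w : R[i]) :=
  has_cint G (fun z => (z - w)^-1 : R[i]^o) two_pi_i.

Definition spectral_contour (A : banachAlgType R) (a : A) G :=
  contour_in G (right_half_plane `\` spectrum a) /\
  forall w, (spectrum a `&` right_half_plane) w -> winds_once G w.

(* The Riesz integral takes the value E for every admissible contour; the first
   conjunct rules out vacuity. *)
Definition is_spectral_idempotent (A : banachAlgType R) (a E : A) :=
  (exists G, spectral_contour a G) /\
  forall G, spectral_contour a G ->
    exists2 I : A, has_cint G (fun z => (z%:A - a)^-1) I &
                   E = two_pi_i^-1 *: I.

End contour_integral.

(* Main.v *)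
(** Let [G] be a closed contour in the right half plane avoiding Sp(a), and put
    [I_G] for the integral of (z - a)^-1 and [n_G(w)] for that of (z - w)^-1.
    The Cauchy transform [D_G(w)], the integral of (z - w)^-1 (z - a)^-1,
    satisfies (w - a) D_G(w) = n_G(w) - I_G.  If every w in Sp(a) has
    n_G(w) = m or n_G'(w) = m', these identities extend the function
    (I_G - m) (I_G' - m') (w - a)^-1 across Sp(a) to an entire function that
    vanishes at infinity, so (I_G - m) (I_G' - m') = 0 by Liouville's theorem.
    This one identity makes I_G / (2 pi i) idempotent and independent of [G], and
    gives I_G = m when n_G = m on all of Sp(a).

    With E = I_G / (2 pi i) for a circle [G] enclosing the part of Sp(a) in the
    right half plane, [D_G(w)] inverts w - a modulo E or 1 - E, whence
    N = a (2 E - 1) has spectrum in the right half plane; as N^2 = a^2 this gives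
    sign a = 2 E - 1.  Square roots with spectrum in the right half plane are
    unique: h = y - y' satisfies y h = - h y', so (z - y)^-1 h = h (z + y')^-1,
    and integrating along a circle around Sp(y) gives 2 pi i h = 0.  Uniqueness
    of the root yields the remaining algebraic properties and, since adjoints
    exist by Riesz representation, the behaviour under adjoints. *)
Require Import Defs.
From mathcomp Require Import all_boot all_order all_algebra.
From mathcomp Require Import complex.
From mathcomp Require Import all_classical all_reals all_analysis.
From mathcomp Require Import ring lra.
Import Order.TTheory GRing.Theory Num.Theory.
Import numFieldNormedType.Exports.
Local Open Scope classical_set_scope.
Local Open Scope ring_scope.
Local Open Scope complex_scope.
Set Implicit Arguments.
Unset Strict Implicit.
Unset Printing Implicit Defensive.

(** * Norms and inverses in Banach algebras *)

(** Extending one function by several formulas and closing with Liouville's theorem is Dixon's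
    argument for the homology form of Cauchy's theorem, applied here to resolvents. It copes with an
    arbitrary admissible contour: no deformation of contours and no functional calculus enters, and
    the only closed integrals computed outright are those of functions with a primitive and that of
    [(z - c)^-1] around a circle with centre [c]. The alternative between [m] and [m'] lets two
    contours share the work. For contours around the right part of the spectrum, [m = 2 pi i] covers
    that part and [m' = 0] the left part, although neither winding number need be constant on the
    whole spectrum. Differentiability is taken in a two-point form throughout. This makes
    derivatives continuous for free and reduces the fundamental theorem of calculus to a sum of
    increments, so that Liouville's theorem needs no Cauchy formula: the mean over a circle is shown
    not to depend on the radius. *)

Local Notation normc := Normc.normc.

Section banach_norm.
Variables (R : realType) (A : banachAlgType R).
Implicit Types (x y : A) (r : R) (k : R[i]).

Lemma normcR r : normc r%:C = `|r|.
Proof. by rewrite /= expr0n addr0 sqrtr_sqr. Qed.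

Lemma normc_ge0 k : 0 <= normc k.
Proof. exact: le_trans (normr_ge0 _) (Defs.normc_ge_Re k). Qed.

Lemma normc_gt0 k : k != 0 -> 0 < normc k.
Proof.
move=> k0; rewrite lt_neqAle normc_ge0 andbT eq_sym.
by apply: contra k0 => /eqP/Normc.eq0_normc ->.
Qed.

Lemma bnorm0 : bnorm (0 : A) = 0.
Proof. by rewrite -(scale0r 1) bnormZ Normc.normc0 mul0r. Qed.

Lemma bnormN x : bnorm (- x) = bnorm x.
Proof. by rewrite -scaleN1r bnormZ normcN Normc.normc1 mul1r. Qed.

Lemma bnorm_ge0 x : 0 <= bnorm x.
Proof. by have := bnormD x (- x); rewrite subrr bnorm0 bnormN; lra. Qed.

Lemma bnormZr r x : bnorm (r%:C *: x) = `|r| * bnorm x.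
Proof. by rewrite bnormZ normcR. Qed.

Lemma bnormB x y : bnorm (x - y) <= bnorm x + bnorm y.
Proof. by rewrite (le_trans (bnormD _ _)) // bnormN. Qed.

Lemma bnormBC x y : bnorm (x - y) = bnorm (y - x).
Proof. by rewrite -bnormN opprB. Qed.

Lemma bnorm_tri x y z : bnorm (x - z) <= bnorm (x - y) + bnorm (y - z).
Proof. by rewrite -[x - z](subrKA y) bnormD. Qed.

Lemma bnorm_sum (I : Type) (s : seq I) (F : I -> A) (P : pred I) :
  bnorm (\sum_(i <- s | P i) F i) <= \sum_(i <- s | P i) bnorm (F i).
Proof.
elim/big_ind2: _ => [|x a y b xa yb|//]; first by rewrite bnorm0.
by rewrite (le_trans (bnormD _ _)) // lerD.
Qed.

Lemma bnorm_small x : (forall e : R, 0 < e -> bnorm x <= e) -> x = 0.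
Proof.
move=> xe; apply: bnorm0_eq0; apply/le_anti; rewrite bnorm_ge0 andbT.
by apply/ler_addgt0Pr => e e0; rewrite add0r xe.
Qed.

Lemma bnormX x n : bnorm (x ^+ n) <= bnorm x ^+ n.
Proof.
elim: n => [|n IH]; first by rewrite !expr0 bnorm1.
by rewrite !exprS (le_trans (bnormM _ _)) // ler_wpM2l // bnorm_ge0.
Qed.

Lemma scalar_comm k x : k%:A * x = x * k%:A.
Proof. by rewrite mulr_algl mulr_algr. Qed.

Lemma invrP x y : x * y = 1 -> y * x = 1 -> x \is a GRing.unit /\ x^-1 = y.
Proof.
move=> xy yx; have ux : x \is a GRing.unit by apply/unitrP; exists y.
by split => //; rewrite -[LHS]mulr1 -xy mulKr.
Qed.

Lemma geom_small (q : R) : 0 <= q < 1 ->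
  forall e, 0 < e -> exists N, forall n, (N <= n)%N -> q ^+ n < e.
Proof.
move=> /andP[q0 q1] e e0.
have /cvgrPdist_lt/(_ _ e0)[N _ h] : (fun n => q ^+ n) @ \oo --> (0 : R).
  by apply: cvg_expr; rewrite ger0_norm.
by exists N => n /h; rewrite sub0r normrN ger0_norm ?exprn_ge0.
Qed.

(** The geometric series converges by completeness, and its partial sums [s n] invert [1 - x] on
    either side up to [x ^+ n]. *)
Lemma neumann x : bnorm x < 1 -> 1 - x \is a GRing.unit.
Proof.
move=> x1; set q := bnorm x; have q0 : 0 <= q := bnorm_ge0 x.
pose s n := \sum_(i < n) x ^+ i.
have sE n : (1 - x) * s n = 1 - x ^+ n by rewrite -[RHS]opprB subrX1 -mulNr opprB.
have sE' n : s n * (1 - x) = 1 - x ^+ n.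
  rewrite -sE /s; apply: (@commr_sym _ (1 - x)); apply: commr_sum => k _.
  by apply/commrX/commr_sym/commrB; [exact: commr1 | exact: commr_refl].
have sD m n : (n <= m)%N -> bnorm (s m - s n) <= q ^+ n / (1 - q).
  move=> nm; rewrite /s -!(big_mkord xpredT (fun i => x ^+ i)).
  rewrite (big_cat_nat (leq0n n) nm) //= addrAC subrr add0r.
  rewrite -{1}[n]add0n big_addn (le_trans (bnorm_sum _ _ _)) //.
  apply: (@le_trans _ _ (\sum_(0 <= i < m - n) q ^+ n * q ^+ i)).
    by apply: ler_sum => i _; rewrite -exprD addnC bnormX.
  rewrite -big_distrr /= ler_wpM2l ?exprn_ge0 // big_mkord.
  rewrite -[leRHS]mul1r ler_pdivlMr ?subr_gt0 // mulrC.
  have := subrX1 q (m - n); set S := \sum_(i < _) _ => h.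
  have : 0 <= q ^+ (m - n) by rewrite exprn_ge0.
  by move: h; lra.
have q1 : 0 < 1 - q by rewrite subr_gt0.
have [|l sl] := bnorm_complete s.
  move=> e e0; have [|N hN] := @geom_small q _ (e * (1 - q)) (mulr_gt0 e0 q1).
    by rewrite q0.
  exists N => m n Nm Nn; wlog nm : m n Nm Nn / (n <= m)%N.
    by move=> W; case: (leqP n m) => [/W|/ltnW/W]; [|rewrite bnormBC]; apply.
  by rewrite (le_lt_trans (sD _ _ nm)) // ltr_pdivrMr // hN.
(* Passage to the limit for left and right multiplication by [1 - x] at once. *)
have lim (f : A -> A) : (forall y, bnorm (f y) <= bnorm y * (1 + q)) ->
    (forall n, 1 - f l = f (s n - l) + x ^+ n) -> f l = 1.
  move=> fB fE; apply/eqP; rewrite eq_sym -subr_eq0; apply/eqP/bnorm_small => e e0.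
  have e2 : 0 < e / 2 by lra.
  have [M hM] := sl _ (divr_gt0 e2 (ltr_wpDr q0 ltr01)).
  have [|N hN] := @geom_small q _ (e / 2) e2; first by rewrite q0.
  rewrite (fE (maxn M N)) (le_trans (bnormD _ _)) // [e]splitr lerD //.
    rewrite (le_trans (fB _)) // -ler_pdivlMr ?ltr_wpDr // ltW // hM //.
    exact: leq_maxl.
  by rewrite (le_trans (bnormX _ _)) // ltW // hN // leq_maxr.
have nx : bnorm (1 - x) <= 1 + q by rewrite (le_trans (bnormB _ _)) // bnorm1.
apply/unitrP; exists l; split.
- apply: (lim (fun y => y * (1 - x))) => [y|n].
    by rewrite (le_trans (bnormM _ _)) // ler_wpM2l // bnorm_ge0.
  by rewrite (mulrBl _ (s n)) sE' addrAC subrK.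
- apply: (lim (fun y => (1 - x) * y)) => [y|n].
    by rewrite (le_trans (bnormM _ _)) // mulrC ler_wpM2l // bnorm_ge0.
  by rewrite (mulrBr _ (s n)) sE addrAC subrK.
Qed.

(** With [d = 1 / (2 |x^-1|)], [y] is [x] times a Neumann perturbation of 1, and
    [y^-1 = x^-1 - y^-1 (y - x) x^-1] gives [|y^-1| <= |x^-1| + |y^-1| / 2]. The explicit bound is
    what later yields continuity of the inverse and differentiability of the resolvent. *)
Lemma unit_near x : x \is a GRing.unit -> exists2 d : R, 0 < d &
  forall y, bnorm (y - x) < d ->
    y \is a GRing.unit /\ bnorm y^-1 <= 2 * bnorm x^-1.
Proof.
move=> ux; set m := bnorm x^-1.
have m0 : 0 < m.
  rewrite lt_neqAle bnorm_ge0 andbT eq_sym; apply/eqP => /bnorm0_eq0 xV0.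
  by have := divrr ux; rewrite xV0 mulr0 => /eqP; rewrite eq_sym oner_eq0.
exists ((2 * m)^-1); first by rewrite invr_gt0; lra.
move=> y; rewrite -[_^-1]mul1r ltr_pdivlMr; last by lra.
move=> xy; have uy : y \is a GRing.unit.
  have -> : y = x * (1 - x^-1 * (x - y)) by rewrite mulrBr mulr1 mulVKr // subKr.
  rewrite unitrMr // neumann //.
  rewrite (le_lt_trans (bnormM _ _)) // bnormBC -/m.
  by have := bnorm_ge0 (y - x); nra.
split=> //.
have yE : y^-1 = x^-1 - y^-1 * (y - x) * x^-1.
  by rewrite mulrBr mulVr // mulrBl mul1r mulrK // subKr.
have := bnormB x^-1 (y^-1 * (y - x) * x^-1).
have := bnormM (y^-1 * (y - x)) x^-1; have := bnormM y^-1 (y - x).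
rewrite -yE -/m; set p := bnorm y^-1; set u := bnorm _; set v := bnorm _.
set d := bnorm (y - x) in xy * => h1 h2 h3.
have p0 : 0 <= p := bnorm_ge0 _.
have : u * m <= p * d * m by rewrite ler_wpM2r // ltW.
have : p * (d * (2 * m)) <= p * 1 by rewrite ler_wpM2l // ltW.
rewrite -/u -/v in h1 h2 h3; lra.
Qed.

End banach_norm.

(** * Riemann integration on [0, 1] *)

Section unit_interval.
Variable R : realType.
Implicit Types (d t u v e : R).

(** Compactness as a uniformity principle: local radii [d] are replaced by a single one. Uniform
    continuity, boundedness, the fundamental theorem of calculus, Liouville's theorem and the
    spectral gap all use compactness in this form. *)
Lemma compact01 (Q : R -> R -> Prop) :
  (forall d d' t, 0 < d' -> d' <= d -> Q d t -> Q d' t) ->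
  (forall t, 0 <= t <= 1 -> exists2 d, 0 < d &
     forall u, 0 <= u <= 1 -> `|u - t| < d -> Q d u) ->
  exists2 d, 0 < d & forall t, 0 <= t <= 1 -> Q d t.
Proof.
move=> Qle Qloc.
have /compact_near_coveringP := @segment_compact R 0 1.
(* The near-covering form of compactness, for the filter of positive [d] tending to 0. *)
move=> /(_ R (0 : R)^'+ (fun d t => 0 <= t <= 1 -> Q d t) _)[].
  move=> t /=; rewrite in_itv /= => /Qloc[d d0 dQ].
  exists ([set u | `|t - u| < d], [set d' | 0 < d' <= d]) => /=.
    split; first by exists d.
    exists d => //= d' /=; rewrite sub0r normrN => d'd d'0.
    by rewrite d'0 ltW // (le_lt_trans (ler_norm _)).
  move=> [u d'] /= [tu /andP[d'0 d'd]] u01.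
  by apply: Qle d'0 d'd _; apply: dQ; rewrite // distrC.
move=> d /= d0 dQ; exists (d / 2); first by rewrite divr_gt0.
move=> t t01; have d2 : 0 < d / 2 by rewrite divr_gt0.
apply: (dQ (d / 2)) => //=.
by rewrite sub0r normrN gtr0_norm //; lra.
Qed.

(** The difference [Num.min x v - Num.min x u] is the length of the part of the interval from [u] to
    [v] that lies below [x]. *)
Lemma min_sub_le (x y u v : R) : x <= y -> u <= v ->
  Num.min x v - Num.min x u <= Num.min y v - Num.min y u.
Proof.
move=> xy uv; case: (leP x v); case: (leP x u); case: (leP y v); case: (leP y u).
all: lra.
Qed.

End unit_interval.

Section integration.
Variables (R : realType) (A : banachAlgType R).
Implicit Types (f g : R -> A) (d e t u v : R).

(** Spelled out with [bnorm], since a [banachAlgType] carries no topology of its own. *)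
Definition cont01 f := forall t, 0 <= t <= 1 -> forall e, 0 < e ->
  exists2 d, 0 < d & forall u, 0 <= u <= 1 -> `|u - t| < d ->
    bnorm (f u - f t) < e.

Lemma cont01_unif f : cont01 f -> forall e, 0 < e -> exists2 d, 0 < d &
  forall u v, 0 <= u <= 1 -> 0 <= v <= 1 -> `|u - v| < d ->
    bnorm (f u - f v) < e.
Proof.
move=> fc e e0.
have [|t /fc/(_ (e / 2))[|d d0 df]|d d0 df] := @compact01 R (fun d t =>
    forall u, 0 <= u <= 1 -> `|u - t| < d -> bnorm (f u - f t) < e).
- by move=> d d' t _ d'd h u u01 ut; apply: h => //; exact: lt_le_trans ut d'd.
- by rewrite divr_gt0.
- exists (d / 2); first by rewrite divr_gt0.
  move=> v v01 vt u u01 uv; rewrite (le_lt_trans (bnorm_tri _ (f t) _)) //.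
  rewrite [e]splitr ltrD // ?(bnormBC (f t)) df //.
    by have := ler_normD (u - v) (v - t); rewrite addrA subrK; move: uv vt; lra.
  by move: vt; lra.
- by exists d => // u v u01 v01 uv; exact: df.
Qed.

Definition tagged d n (t s : nat -> R) :=
  [/\ t 0%N = 0, t n = 1 & forall i, (i < n)%N ->
    t i <= s i <= t i.+1 /\ t i.+1 - t i < d].

Definition rsum f n (t s : nat -> R) : A :=
  \sum_(i < n) (t i.+1 - t i)%:C *: f (s i).

Lemma tagged01 d n (t s : nat -> R) i : tagged d n t s -> (i <= n)%N ->
  0 <= t i <= 1.
Proof.
move=> [t0 t1 tP] ni.
have mono j k : (j + k <= n)%N -> t j <= t (j + k)%N.
  elim: k => [|k IH] jk; first by rewrite addn0.
  have jk' : (j + k < n)%N by rewrite -addnS.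
  have [/andP[h1 h2] _] := tP _ jk'.
  by rewrite addnS (le_trans (IH (ltnW jk'))) // (le_trans h1).
have := mono 0%N i; have := mono i (n - i)%N.
by rewrite add0n subnKC // t0 t1 leqnn => -> // ->.
Qed.

Lemma tagged_tag01 d n (t s : nat -> R) i : tagged d n t s -> (i < n)%N ->
  0 <= s i <= 1.
Proof.
move=> tt ni; have [_ _ /(_ _ ni)[]] := tt.
have := tagged01 tt (ltnW ni); have := tagged01 tt ni; lra.
Qed.

(* The weights [w i k] are the lengths of the intersections of the intervals of
   the two partitions. *)
Lemma rsum_close f e d n n' (t s t' s' : nat -> R) : 0 <= e ->
  tagged d n t s -> tagged d n' t' s' ->
  (forall u v, 0 <= u <= 1 -> 0 <= v <= 1 -> `|u - v| < 2 * d ->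
     bnorm (f u - f v) <= e) ->
  bnorm (rsum f n t s - rsum f n' t' s') <= e.
Proof.
move=> e0 tt tt' fe; have [t0 t1 tP] := tt; have [t'0 t'1 t'P] := tt'.
(* Length of the part of the [k]-th interval of the second partition to the left of [x]. *)
pose psi k x := Num.min x (t' k.+1) - Num.min x (t' k).
pose w i k := psi k (t i.+1) - psi k (t i).
have minE (a b : R) : a <= b -> Num.min a b = a by move=> /min_idPl.
have minE' (a b : R) : b <= a -> Num.min a b = b by move=> /min_idPr.
have sum1 i : (i < n)%N -> \sum_(k < n') w i k = t i.+1 - t i.
  move=> ni; have psiE x : 0 <= x <= 1 -> \sum_(k < n') psi k x = x.
    move=> /andP[x0 x1]; rewrite -(big_mkord xpredT (psi^~ x)).
    rewrite (telescope_sumr (fun k => Num.min x (t' k))) //.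
    by rewrite t'0 t'1 minE // minE' // subr0.
  by rewrite sumrB !psiE // ?(tagged01 tt) // ltnW.
have sum2 k : (k < n')%N -> \sum_(i < n) w i k = t' k.+1 - t' k.
  move=> nk; rewrite -(big_mkord xpredT (w^~ k)).
  rewrite (telescope_sumr (fun i => psi k (t i))) // t0 t1 /psi.
  have := tagged01 tt' nk; have := tagged01 tt' (ltnW nk).
  by move=> /andP[? ?] /andP[? ?]; rewrite !(minE' 1) // !(minE 0) // subrr subr0.
have -> : rsum f n t s = \sum_(i < n) \sum_(k < n') (w i k)%:C *: f (s i).
  by apply: eq_bigr => i _; rewrite -sum1 // raddf_sum scaler_suml.
have -> : rsum f n' t' s' = \sum_(i < n) \sum_(k < n') (w i k)%:C *: f (s' k).
  rewrite exchange_big; apply: eq_bigr => k _ /=.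
  by rewrite -sum2 // raddf_sum scaler_suml.
rewrite -sumrB.
apply: (@le_trans _ _ (\sum_(i < n) \sum_(k < n') w i k * e)); last first.
  under eq_bigr => i _ do rewrite -mulr_suml sum1 //.
  rewrite -mulr_suml -(big_mkord xpredT (fun i => t i.+1 - t i)).
  by rewrite telescope_sumr // t0 t1 subr0 mul1r.
rewrite (le_trans (bnorm_sum _ _ _)) // ler_sum // => i _.
rewrite -sumrB (le_trans (bnorm_sum _ _ _)) // ler_sum // => k _.
rewrite -scalerBr bnormZr.
have [/andP[h1 h2] h3] := tP _ (ltn_ord i).
have [/andP[h1' h2'] h3'] := t'P _ (ltn_ord k).
(* Intervals that do not overlap have weight 0; the tags of two overlapping ones differ by less than
   [2 * d]. *)
have [h4|h4] := leP (t i.+1) (t' k).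
  have -> : w i k = 0 by rewrite /w /psi !minE; lra.
  by rewrite normr0 !mul0r.
have [h5|h5] := leP (t' k.+1) (t i).
  have -> : w i k = 0 by rewrite /w /psi !minE'; lra.
  by rewrite normr0 !mul0r.
have w0 : 0 <= w i k.
  by rewrite subr_ge0 /psi min_sub_le // (le_trans h1, le_trans h1').
rewrite ger0_norm // ler_wpM2l // fe //.
- exact: tagged_tag01 tt _.
- exact: tagged_tag01 tt' _.
- by rewrite ltr_norml; apply/andP; split; lra.
Qed.

Lemma tagged_uniform d : 0 < d -> exists N, forall n, (N <= n)%N ->
  tagged d n.+1 (fun i => i%:R / n.+1%:R) (fun i => i%:R / n.+1%:R).
Proof.
move=> d0; exists (Num.trunc d^-1).+1 => n Nn.
have n0 : 0 < n.+1%:R :> R by rewrite ltr0n.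
have dn : n.+1%:R^-1 < d.
  rewrite -[d]invrK ltf_pV2 ?posrE ?invr_gt0 //.
  rewrite (lt_le_trans (truncnS_gt _)) // ler_nat; exact: leqW.
split => [||i ni]; rewrite ?mul0r ?divff ?gt_eqF //.
rewrite lexx ler_pM2r ?invr_gt0 // ler_nat leqnSn; split => //.
by rewrite -mulrBl -natrB // subSnn mul1r.
Qed.

Lemma has_RintP f (I : A) : has_Rint f 0 1 I <->
  forall e, 0 < e -> exists2 d, 0 < d & forall n (t s : nat -> R),
    tagged d n t s -> bnorm (rsum f n t s - I) < e.
Proof.
split=> h e /h[d d0 dP]; exists d => // n t s; first by case=> *; exact: dP.
by move=> *; exact: dP.
Qed.

Lemma has_Rint_unique f I J : has_Rint f 0 1 I -> has_Rint f 0 1 J -> I = J.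
Proof.
move=> /has_RintP hI /has_RintP hJ; apply/subr0_eq/bnorm_small => e e0.
have e2 : 0 < e / 2 by lra.
have [d d0 dI] := hI _ e2; have [d' d'0 dJ] := hJ _ e2.
have [N /(_ N (leqnn _)) tI] := tagged_uniform d0.
have [N' hN'] := tagged_uniform d'0; have [M hM] := tagged_uniform d0.
set m := maxn M N'.
have := dI _ _ _ (hM m (leq_maxl _ _)); have := dJ _ _ _ (hN' m (leq_maxr _ _)).
set S := rsum _ _ _ _ => h1 h2.
by have := bnorm_tri I S J; rewrite (bnormBC I S); move: h1 h2; lra.
Qed.

(** By [rsum_close] any two sufficiently fine sums are close, so those over uniform partitions
    converge, and every other fine sum is close to their limit. *)
Lemma cont01_has_Rint f : cont01 f -> exists I, has_Rint f 0 1 I.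
Proof.
move=> fc.
have close e : 0 < e -> exists2 d, 0 < d & forall n n' (t s t' s' : nat -> R),
    tagged d n t s -> tagged d n' t' s' ->
    bnorm (rsum f n t s - rsum f n' t' s') < e.
  move=> e0; have [|d d0 df] := cont01_unif fc (e := e / 2); first by lra.
  exists (d / 2) => [|n n' t s t' s' tt tt']; first by lra.
  apply: (@le_lt_trans _ _ (e / 2)); last by lra.
  apply: rsum_close tt tt' _ => [|u v u01 v01 uv]; first by lra.
  by apply/ltW/df => //; move: uv; lra.
pose V n := rsum f n.+1 (fun i => i%:R / n.+1%:R) (fun i => i%:R / n.+1%:R).
have [|I VI] := bnorm_complete V.
  move=> e /close[d d0 df]; have [N hN] := tagged_uniform d0.
  by exists N => m n Nm Nn; apply: df; exact: hN.
exists I; apply/has_RintP => e e0; have e2 : 0 < e / 2 by lra.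
have [d d0 df] := close _ e2; exists d => // n t s tt.
have [N hN] := tagged_uniform d0; have [M hM] := VI _ e2.
have := df _ _ _ _ _ _ tt (hN (maxn M N) (leq_maxr _ _)).
have := hM (maxn M N) (leq_maxl _ _); rewrite -/(V _).
by have := bnorm_tri (rsum f n t s) (V (maxn M N)) I; lra.
Qed.

Lemma eq_has_Rint f g I : (forall t, 0 <= t <= 1 -> f t = g t) ->
  has_Rint f 0 1 I -> has_Rint g 0 1 I.
Proof.
move=> fg /has_RintP h; apply/has_RintP => e /h[d d0 df]; exists d => // n t s tt.
have := df _ _ _ tt; congr (bnorm (_ - _) < _); apply: eq_bigr => i _.
by rewrite fg //; exact: tagged_tag01 tt _.
Qed.

Lemma tagged_sum d n (t s : nat -> R) (c : R) : tagged d n t s ->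
  \sum_(i < n) (t i.+1 - t i) * c = c.
Proof.
move=> [t0 t1 _]; rewrite -mulr_suml -(big_mkord xpredT (fun i => t i.+1 - t i)).
by rewrite telescope_sumr // t0 t1 subr0 mul1r.
Qed.

Lemma has_Rint_le f I M : has_Rint f 0 1 I ->
  (forall t, 0 <= t <= 1 -> bnorm (f t) <= M) -> bnorm I <= M.
Proof.
move=> /has_RintP h fM; apply/ler_addgt0Pr => e /h[d d0 df].
have [N /(_ N (leqnn _)) tt] := tagged_uniform d0.
have := df _ _ _ tt; move: tt; set t := fun i => _; move=> tt.
have : bnorm (rsum f N.+1 t t) <= M.
  rewrite -(tagged_sum M tt) (le_trans (bnorm_sum _ _ _)) // ler_sum // => i _.
  have [_ _ /(_ _ (ltn_ord i))[h1 _]] := tt.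
  rewrite bnormZr ger0_norm; last by move: h1; lra.
  by rewrite ler_wpM2l ?fM ?(tagged_tag01 tt) //; move: h1; lra.
have := bnorm_tri I (rsum f N.+1 t t) 0; rewrite !subr0 bnormBC.
lra.
Qed.

Lemma has_RintD f g I J : has_Rint f 0 1 I -> has_Rint g 0 1 J ->
  has_Rint (fun t => f t + g t) 0 1 (I + J).
Proof.
move=> /has_RintP hf /has_RintP hg; apply/has_RintP => e e0.
have e2 : 0 < e / 2 by lra.
have [d d0 df] := hf _ e2; have [d' d'0 dg] := hg _ e2.
exists (Num.min d d') => [|n t s [t0 t1 tP]]; first by rewrite lt_min d0.
have tt : tagged d n t s.
  by split=> // i /tP[? h]; split=> //; rewrite (lt_le_trans h) // ge_min lexx.
have tt' : tagged d' n t s.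
  by split=> // i /tP[? h]; split=> //; rewrite (lt_le_trans h) // ge_min lexx orbT.
have -> : rsum (fun t => f t + g t) n t s = rsum f n t s + rsum g n t s.
  by rewrite /rsum -big_split; apply: eq_bigr => i _; rewrite scalerDr.
rewrite opprD addrACA (le_lt_trans (bnormD _ _)) // [e]splitr.
by rewrite ltrD // ?(df _ _ _ tt) // (dg _ _ _ tt').
Qed.

Lemma cont01_cst (x : A) : cont01 (fun=> x).
Proof.
by move=> t _ e e0; exists 1 => // u _ _; rewrite subrr bnorm0.
Qed.

Lemma eq_cont01 f g : (forall t, 0 <= t <= 1 -> f t = g t) -> cont01 f -> cont01 g.
Proof.
move=> fg fc t t01 e /(fc t t01)[d d0 df]; exists d => // u u01 ut.
by rewrite -!fg // df.
Qed.

Lemma cont01D f g : cont01 f -> cont01 g -> cont01 (fun t => f t + g t).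
Proof.
move=> fc gc t t01 e e0; have e2 : 0 < e / 2 by lra.
have [d d0 df] := fc t t01 _ e2; have [d' d'0 dg] := gc t t01 _ e2.
exists (Num.min d d') => [|u u01]; rewrite lt_min ?d0 // => /andP[h h'].
rewrite opprD addrACA (le_lt_trans (bnormD _ _)) // [e]splitr.
by rewrite ltrD // ?df // dg.
Qed.

Lemma cont01N f : cont01 f -> cont01 (fun t => - f t).
Proof.
move=> fc t t01 e /(fc t t01)[d d0 df]; exists d => // u u01 ut.
by rewrite -opprD bnormN df.
Qed.

Lemma cont01B f g : cont01 f -> cont01 g -> cont01 (fun t => f t - g t).
Proof. by move=> fc gc; apply: cont01D => //; exact: cont01N. Qed.

Lemma cont01M f g : cont01 f -> cont01 g -> cont01 (fun t => f t * g t).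
Proof.
move=> fc gc t t01 e e0; have f0 := bnorm_ge0 (f t); have g0 := bnorm_ge0 (g t).
set K := bnorm (f t) + bnorm (g t) + 1; have K0 : 0 < K by rewrite /K; lra.
(* The cap at 1 bounds [bnorm (f u)] by [bnorm (f t) + 1]; the other entry keeps [K * r] below
   [e / 2]. *)
pose r := Num.min 1 (e / (2 * K)).
have r0 : 0 < r by rewrite lt_min ltr01 divr_gt0 ?mulr_gt0.
have r1 : r <= 1 by rewrite ge_min lexx.
have rK : K * r <= e / 2.
  rewrite mulrC -ler_pdivlMr // ge_min; apply/orP; right.
  by rewrite invfM mulrA.
have [d d0 df] := fc t t01 _ r0; have [d' d'0 dg] := gc t t01 _ r0.
exists (Num.min d d') => [|u u01]; rewrite lt_min ?d0 // => /andP[/df h /dg h'].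
move: (h u01) (h' u01) => {}h {}h'.
have -> : f u * g u - f t * g t = f u * (g u - g t) + (f u - f t) * g t.
  by rewrite mulrBr mulrBl addrA subrK.
have := bnormD (f u * (g u - g t)) ((f u - f t) * g t).
have := bnormM (f u) (g u - g t); have := bnormM (f u - f t) (g t).
have := bnorm_tri (f u) (f t) 0; rewrite !subr0.
have := bnorm_ge0 (f u - f t); have := bnorm_ge0 (g u - g t).
set a := bnorm (f u - f t) in h *; set b := bnorm (g u - g t) in h' *.
set c := bnorm (f u) => b0 a0 ca h1 h2 h3.
have cK : c * b <= (bnorm (f t) + 1) * b by rewrite ler_wpM2r //; lra.
have : (bnorm (f t) + 1) * b <= (bnorm (f t) + 1) * r by rewrite ler_wpM2l; lra.
have : a * bnorm (g t) <= r * bnorm (g t) by rewrite ler_wpM2r; lra.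
rewrite /K in rK; lra.
Qed.

Lemma cont01V f : cont01 f -> (forall t, 0 <= t <= 1 -> f t \is a GRing.unit) ->
  cont01 (fun t => (f t)^-1).
Proof.
move=> fc fu t t01 e e0; have [d d0 dP] := unit_near (fu t t01).
set m := bnorm (f t)^-1 in dP; have m0 : 0 <= m := bnorm_ge0 _.
pose K := 2 * m * m + 1; have K0 : 0 < K by rewrite /K; nra.
have [d1 d10 h1] := fc t t01 _ d0.
have [d2 d20 h2] := fc t t01 _ (divr_gt0 e0 K0).
exists (Num.min d1 d2) => [|u u01]; rewrite lt_min ?d10 // => /andP[/h1 a /h2 b].
have [uu ub] := dP _ (a u01); have {b} := b u01; rewrite ltr_pdivlMr //.
have -> : (f u)^-1 - (f t)^-1 = (f u)^-1 * (f t - f u) * (f t)^-1.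
  by rewrite mulrBr mulVr // mulrBl mul1r -mulrA divrr ?mulr1 ?fu.
have := bnormM ((f u)^-1 * (f t - f u)) (f t)^-1.
have := bnormM (f u)^-1 (f t - f u); rewrite (bnormBC (f t)) -/m.
set x := bnorm (f u - f t); set p := bnorm _^-1 in ub *; have : 0 <= x := bnorm_ge0 _.
set v := bnorm _; set w := bnorm _ => x0 h3 h4 h5.
have : p * x * m <= 2 * m * x * m by rewrite !ler_wpM2r.
have : v * m <= p * x * m by rewrite ler_wpM2r.
rewrite /K in h5; lra.
Qed.

Lemma cont01_bounded f : cont01 f ->
  exists2 M, 0 < M & forall t, 0 <= t <= 1 -> bnorm (f t) <= M.
Proof.
move=> fc.
(* The uniform radius serves as the reciprocal of the bound. *)
have [||d d0 h] := @compact01 R (fun d t => d * bnorm (f t) <= 1).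
- by move=> d d' t _ d'd; apply: le_trans; rewrite ler_wpM2r ?bnorm_ge0.
- move=> t t01; have [d d0 df] := fc t t01 _ ltr01.
  have f1 : 0 < bnorm (f t) + 1 by have := bnorm_ge0 (f t); lra.
  exists (Num.min d (bnorm (f t) + 1)^-1); first by rewrite lt_min d0 invr_gt0.
  move=> u u01; rewrite lt_min => /andP[/(df _ u01) h _].
  apply: (@le_trans _ _ ((bnorm (f t) + 1)^-1 * (bnorm (f t) + 1))); last first.
    by rewrite mulVf // gt_eqF.
  rewrite ler_pM ?bnorm_ge0 //.
  + by rewrite le_min !ltW ?invr_gt0.
  + by rewrite ge_min lexx orbT.
  + by have := bnorm_tri (f u) (f t) 0; rewrite !subr0; move: h; lra.
- exists d^-1; first by rewrite invr_gt0.
  by move=> t /h; rewrite mulrC -ler_pdivlMr // div1r.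
Qed.

End integration.

Section bounded_linear.
Variables (R : realType) (A B : banachAlgType R) (L : A -> B) (K : R).
Hypothesis LB : forall x y, L (x - y) = L x - L y.
Hypothesis LZ : forall (r : R) x, L (r%:C *: x) = r%:C *: L x.
Hypothesis Lle : forall x, bnorm (L x) <= K * bnorm x.

Let L0 : L 0 = 0. Proof. by rewrite -[X in L X](subrr 0) LB subrr. Qed.

Let LD x y : L (x + y) = L x + L y.
Proof. by rewrite -{1}[y]opprK LB -[- y]sub0r LB L0 sub0r opprK. Qed.

Let K1_gt0 : 0 < `|K| + 1. Proof. by have := normr_ge0 K; lra. Qed.

Let Lle1 x : bnorm (L x) <= bnorm x * (`|K| + 1).
Proof.
rewrite (le_trans (Lle x)) // mulrC ler_wpM2l ?bnorm_ge0 //.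
by have := ler_norm K; lra.
Qed.

Lemma cont01_lin f : cont01 f -> cont01 (fun t => L (f t)).
Proof.
move=> fc t t01 e e0; have [d d0 df] := fc t t01 _ (divr_gt0 e0 K1_gt0).
exists d => // u u01 ut; rewrite -LB (le_lt_trans (Lle1 _)) //.
by rewrite -ltr_pdivlMr // df.
Qed.

(** Riemann sums have real weights, so real homogeneity of [L] suffices. The lemma serves
    multiplication on either side, complex scaling and the embedding of scalars. *)
Lemma has_Rint_lin f I : has_Rint f 0 1 I -> has_Rint (fun t => L (f t)) 0 1 (L I).
Proof.
move=> /has_RintP h; apply/has_RintP => e e0.
have [d d0 df] := h _ (divr_gt0 e0 K1_gt0).
exists d => // n t s tt; have -> : rsum (fun t => L (f t)) n t s = L (rsum f n t s).
  by rewrite (big_morph L LD L0); apply: eq_bigr => i _; rewrite LZ.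
by rewrite -LB (le_lt_trans (Lle1 _)) // -ltr_pdivlMr // df.
Qed.

End bounded_linear.

Section integral_operations.
Variables (R : realType) (A : banachAlgType R).
Implicit Types (f g : R -> A) (d e t u v : R).

Lemma has_Rint_mull f (I x : A) :
  has_Rint f 0 1 I -> has_Rint (fun t => x * f t) 0 1 (x * I).
Proof.
apply: (@has_Rint_lin _ _ _ (fun y => x * y) (bnorm x)) => [y z|r y|y].
- by rewrite mulrBr.
- by rewrite scalerAr.
- exact: bnormM.
Qed.

Lemma has_Rint_mulr f (I x : A) :
  has_Rint f 0 1 I -> has_Rint (fun t => f t * x) 0 1 (I * x).
Proof.
apply: (@has_Rint_lin _ _ _ (fun y => y * x) (bnorm x)) => [y z|r y|y].
- by rewrite mulrBl.
- by rewrite scalerAl.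
- by rewrite mulrC bnormM.
Qed.

Lemma has_RintZ f (I : A) (k : R[i]) :
  has_Rint f 0 1 I -> has_Rint (fun t => k *: f t) 0 1 (k *: I).
Proof.
apply: (@has_Rint_lin _ _ _ (fun y => k *: y) (normc k)) => [y z|r y|y].
- by rewrite scalerBr.
- by rewrite !scalerA mulrC.
- by rewrite bnormZ.
Qed.

Lemma has_RintB f g (I J : A) : has_Rint f 0 1 I -> has_Rint g 0 1 J ->
  has_Rint (fun t => f t - g t) 0 1 (I - J).
Proof.
move=> hf hg; rewrite -[- J]scaleN1r; apply: eq_has_Rint; last first.
  by apply: has_RintD hf _; apply: has_RintZ (-1) hg.
by move=> t _ /=; rewrite scaleN1r.
Qed.

Lemma has_Rint_cst (x : A) : has_Rint (fun=> x) 0 1 x.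
Proof.
apply/has_RintP => e e0; exists 1 => // n t s [t0 t1 _].
rewrite /rsum -scaler_suml -raddf_sum.
rewrite -(big_mkord xpredT (fun i => t i.+1 - t i)) telescope_sumr //.
by rewrite t0 t1 subr0 scale1r subrr bnorm0.
Qed.

Let scalarL_le (k : R[i]^o) : bnorm (k *: (1 : A)) <= 1 * bnorm k.
Proof. by rewrite bnormZ bnorm1 mulr1 mul1r. Qed.

Let scalarLZ (r : R) (k : R[i]^o) : (r%:C *: k) *: (1 : A) = r%:C *: (k *: 1).
Proof. by rewrite scalerA. Qed.

Lemma has_Rint_alg (k : R -> R[i]^o) (I : R[i]^o) :
  has_Rint k 0 1 I -> has_Rint (fun t => (k t)%:A : A) 0 1 (I%:A).
Proof.
apply: (has_Rint_lin _ scalarLZ scalarL_le) => x y.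
by rewrite scalerBl.
Qed.

Lemma cont01_alg (k : R -> R[i]^o) : cont01 k -> cont01 (fun t => (k t)%:A : A).
Proof.
by apply: (cont01_lin _ scalarL_le) => x y; rewrite scalerBl.
Qed.

Lemma cont01Z (k : R -> R[i]^o) f : cont01 k -> cont01 f ->
  cont01 (fun t => (k t : R[i]) *: f t).
Proof.
move=> kc fc; apply: eq_cont01 (cont01M (cont01_alg kc) fc) => t _.
by rewrite mulr_algl.
Qed.

(** Strict differentiability: both ends of the increment move. Such estimates can be summed over a
    partition, with no mean value inequality in [A]. *)
Definition strict_deriv01 (F f : R -> A) := forall t, 0 <= t <= 1 ->
  forall e, 0 < e -> exists2 d, 0 < d & forall u v, 0 <= u <= 1 -> 0 <= v <= 1 ->
    `|u - t| < d -> `|v - t| < d ->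
    bnorm (F u - F v - (u - v)%:C *: f t) <= e * `|u - v|.

(** On a short interval containing the tag, the increment of [F] differs from the term of the
    Riemann sum by at most [e / 2] times the length, and the increments telescope. *)
Lemma Rint_strict_deriv (F f : R -> A) : cont01 f -> strict_deriv01 F f ->
  has_Rint f 0 1 (F 1 - F 0).
Proof.
move=> fc Ff; apply/has_RintP => e e0; have e2 : 0 < e / 2 by lra.
have e4 : 0 < e / 2 / 2 by lra.
have [||d d0 dP] := @compact01 R (fun d t => forall u v, 0 <= u <= 1 ->
    0 <= v <= 1 -> u <= t <= v -> v - u < d ->
    bnorm (F v - F u - (v - u)%:C *: f t) <= e / 2 * (v - u)).
- move=> d d' t _ d'd h u v u01 v01 utv vu; apply: h => //.
  exact: lt_le_trans vu d'd.
- move=> t t01; have [d d0 dF] := Ff t t01 _ e4.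
  have [d' d'0 df] := fc t t01 _ e4.
  exists (Num.min d d' / 2); first by rewrite divr_gt0 // lt_min d0.
  have m1 : Num.min d d' <= d by rewrite ge_min lexx.
  have m2 : Num.min d d' <= d' by rewrite ge_min lexx orbT.
  move: (Num.min d d') m1 m2 => m m1 m2 s s01 st u v u01 v01 usv vu.
  have {}st : - (m / 2) < s - t < m / 2 by move: st; rewrite ltr_norml.
  have -> : F v - F u - (v - u)%:C *: f s =
      F v - F u - (v - u)%:C *: f t - (v - u)%:C *: (f s - f t).
    by rewrite scalerBr opprB addrA subrK.
  rewrite (le_trans (bnormB _ _)) // bnormZr.
  have vu0 : 0 <= v - u by lra.
  have : bnorm (F v - F u - (v - u)%:C *: f t) <= e / 2 / 2 * `|v - u|.
    by apply: dF => //; rewrite ltr_norml; lra.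
  have h : bnorm (f s - f t) < e / 2 / 2.
    by apply: df => //; rewrite ltr_norml; lra.
  by have := ler_wpM2l vu0 (ltW h); rewrite !ger0_norm //; lra.
- exists d => // n t s tt; have [t0 t1 tP] := tt.
  have -> : F 1 - F 0 = \sum_(i < n) (F (t i.+1) - F (t i)).
    rewrite -(big_mkord xpredT (fun i => F (t i.+1) - F (t i))).
    by rewrite (telescope_sumr (fun i => F (t i))) // t0 t1.
  apply: (@le_lt_trans _ _ (e / 2)); last by lra.
  rewrite /rsum -sumrB -(tagged_sum (e / 2) tt).
  rewrite (le_trans (bnorm_sum _ _ _)) // ler_sum // => i _.
  have [h1 h2] := tP _ (ltn_ord i).
  rewrite bnormBC mulrC; apply: dP => //.
  + exact: tagged_tag01 tt _.
  + by rewrite (tagged01 tt) // ltnW.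
  + by rewrite (tagged01 tt).
Qed.

Definition Rint f : A := xget 0 [set I | has_Rint f 0 1 I].

Lemma RintP f : cont01 f -> has_Rint f 0 1 (Rint f).
Proof. by move=> /cont01_has_Rint[I If]; rewrite /Rint; case: xgetP => // /(_ I). Qed.

Lemma RintE f I : has_Rint f 0 1 I -> Rint f = I.
Proof.
rewrite /Rint; case: xgetP => [J _ /= fJ fI|/(_ I) //].
exact: has_Rint_unique fJ fI.
Qed.

End integral_operations.

(** * Complex differentiability and arcs *)

Section strict_differentiability.
Variables (R : realType) (A : banachAlgType R).
Implicit Types (F : R[i] -> A) (z w u v : R[i]) (D : A) (d e : R).

(** The complex two-point derivative. Resolvents and Cauchy transforms satisfy it by direct
    estimates. *)
Definition strict_deriv F z D := forall e, 0 < e -> exists2 d, 0 < d &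
  forall u v, normc (u - z) < d -> normc (v - z) < d ->
    bnorm (F u - F v - (u - v) *: D) <= e * normc (u - v).

Definition cont_at F z := forall e, 0 < e -> exists2 d, 0 < d &
  forall u, normc (u - z) < d -> bnorm (F u - F z) < e.

Lemma strict_deriv_cont F z D : strict_deriv F z D -> cont_at F z.
Proof.
move=> FD e e0; have [d d0 dF] := FD _ ltr01.
have D0 := bnorm_ge0 D; have D1 : 0 < bnorm D + 1 by lra.
exists (Num.min d (e / (bnorm D + 1))) => [|u].
  by rewrite lt_min d0 divr_gt0.
rewrite lt_min ltr_pdivlMr // => /andP[ud ue].
have := dF u z ud; rewrite subrr Normc.normc0 => /(_ d0).
have := bnormD (F u - F z - (u - z) *: D) ((u - z) *: D).
by rewrite subrK bnormZ; lra.
Qed.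

Lemma eq_strict_deriv_near F G z D d : 0 < d ->
  (forall u, normc (u - z) < d -> F u = G u) ->
  strict_deriv F z D -> strict_deriv G z D.
Proof.
move=> d0 FG FD e /FD[d' d'0 dF].
exists (Num.min d d') => [|u v]; rewrite ?lt_min ?d0 //.
by move=> /andP[? ?] /andP[? ?]; rewrite -!FG //; exact: dF.
Qed.

Lemma strict_deriv_mull F z D (x : A) : strict_deriv F z D ->
  strict_deriv (fun w => x * F w) z (x * D).
Proof.
move=> FD e e0; have x1 : 0 < bnorm x + 1 by have := bnorm_ge0 x; lra.
have [d d0 dF] := FD _ (divr_gt0 e0 x1); exists d => // u v ud vd.
rewrite -mulrBr scalerAr -mulrBr (le_trans (bnormM _ _)) //.
have := dF u v ud vd; rewrite mulrAC ler_pdivlMr // mulrDr mulr1 [X in X + _]mulrC.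
by have := bnorm_ge0 (F u - F v - (u - v) *: D); lra.
Qed.

Lemma strict_deriv_mulr F z D (x : A) : strict_deriv F z D ->
  strict_deriv (fun w => F w * x) z (D * x).
Proof.
move=> FD e e0; have x1 : 0 < bnorm x + 1 by have := bnorm_ge0 x; lra.
have [d d0 dF] := FD _ (divr_gt0 e0 x1); exists d => // u v ud vd.
rewrite -mulrBl scalerAl -mulrBl (le_trans (bnormM _ _)) //.
have := dF u v ud vd; rewrite mulrAC ler_pdivlMr // mulrDr mulr1.
by have := bnorm_ge0 (F u - F v - (u - v) *: D); lra.
Qed.

Lemma strict_derivN F z D : strict_deriv F z D ->
  strict_deriv (fun w => - F w) z (- D).
Proof.
move=> FD e /FD[d d0 dF]; exists d => // u v ud vd.
by rewrite scalerN -!opprD bnormN dF.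
Qed.

Lemma normcB_tri (x y z : R[i]) : normc (x - z) <= normc (x - y) + normc (y - z).
Proof. by rewrite -[x - z](subrKA y) le_normcD. Qed.

(** For [w] near [z], a small increment of [F] at [w] is approximated both by [F' w] and by
    [F' z]. *)
Lemma strict_deriv_continuous F (F' : R[i] -> A) :
  (forall z, strict_deriv F z (F' z)) -> forall z, cont_at F' z.
Proof.
move=> FF z e e0; have e4 : 0 < e / 4 by lra.
have [d d0 dF] := FF z _ e4; exists d => // w wd.
have [d' d'0 dF'] := FF w _ e4.
(* Small enough that [w + h] lies within [d] of [z] and within [d'] of [w]. *)
pose h := Num.min (d - normc (w - z)) d' / 2.
have h0 : 0 < h by rewrite divr_gt0 // lt_min d'0 andbT; lra.
have [h1 h2] : h < d - normc (w - z) /\ h < d'.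
  have : 2 * h <= d - normc (w - z) /\ 2 * h <= d'.
    by rewrite mulrC divfK // !ge_min !lexx orbT.
  by lra.
have nh : normc (w + h%:C - w) = h by rewrite addrAC subrr add0r normcR gtr0_norm.
have a := dF (w + h%:C) w; have b := dF' (w + h%:C) w.
rewrite nh subrr Normc.normc0 in a b; have {}b := b h2 d'0.
have {}a : bnorm (F (w + h%:C) - F w - (w + h%:C - w) *: F' z) <= e / 4 * h.
  apply: a wd; apply: le_lt_trans (normcB_tri _ w _) _.
  by rewrite nh; move: h1; lra.
have := bnorm_tri ((w + h%:C - w) *: F' w) (F (w + h%:C) - F w)
  ((w + h%:C - w) *: F' z).
rewrite -scalerBr bnormZ nh [X in _ <= X + _]bnormBC => c.
rewrite -(ltr_pM2l h0) (le_lt_trans c) //.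
by move: a b; have := mulr_gt0 e0 h0; lra.
Qed.

Lemma cont01_comp F (g : R -> R[i]^o) : cont01 g ->
  (forall t, 0 <= t <= 1 -> cont_at F (g t)) -> cont01 (fun t => F (g t)).
Proof.
move=> gc Fc t t01 e e0; have [d d0 dF] := Fc t t01 _ e0.
by have [d' d'0 dg] := gc t t01 _ d0; exists d' => // u u01 ut; apply/dF/dg.
Qed.

Lemma strict_deriv01_comp F (F' : R[i] -> A) (g g' : R -> R[i]^o) :
  cont01 g -> strict_deriv01 g g' ->
  (forall t, 0 <= t <= 1 -> strict_deriv F (g t) (F' (g t))) ->
  strict_deriv01 (fun t => F (g t)) (fun t => (g' t : R[i]) *: F' (g t)).
Proof.
move=> gc gg FF t t01 e e0.
set D := F' (g t); set p := normc (g' t).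
have D0 := bnorm_ge0 D; have p0 : 0 <= p := normc_ge0 _.
(* As [e2 <= 1], an increment of [g] is at most [p + 1] times that of the parameter, which [e1]
   compensates; [e2] compensates the factor [bnorm D]. *)
pose e1 := e / (2 * (p + 1)); pose e2 := Num.min 1 (e / (2 * (bnorm D + 1))).
have e10 : 0 < e1 by rewrite divr_gt0 //; lra.
have e20 : 0 < e2 by rewrite lt_min ltr01 divr_gt0 //; lra.
have [d d0 dF] := FF t t01 _ e10; have [d1 d10 dg] := gc t t01 _ d0.
have [d2 d20 dgg] := gg t t01 _ e20.
exists (Num.min d1 d2) => [|u v u01 v01]; rewrite ?lt_min ?d10 //.
move=> /andP[u1 u2] /andP[v1 v2].
have h1 : bnorm (F (g u) - F (g v) - (g u - g v) *: D) <= e1 * normc (g u - g v).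
  by apply: dF; apply: dg.
have h2 : normc (g u - g v - (u - v)%:C * g' t) <= e2 * `|u - v| by apply: dgg.
have h3 := le_normcD (g u - g v - (u - v)%:C * g' t) ((u - v)%:C * g' t).
rewrite subrK Normc.normcM normcR -/p in h3.
have -> : F (g u) - F (g v) - (u - v)%:C *: ((g' t : R[i]) *: D) =
    (F (g u) - F (g v) - (g u - g v) *: D) +
    ((g u - g v - (u - v)%:C * g' t) : R[i]) *: D.
  have idt (X : A) (k l : R[i]) : X - l *: D = (X - k *: D) + (k - l) *: D.
    by rewrite scalerBl addrA subrK.
  by rewrite scalerA; exact: idt.
rewrite (le_trans (bnormD _ _)) // bnormZ.
set x := `|u - v| in h2 h3 *; have x0 : 0 <= x := normr_ge0 _.
have e21 : e2 <= 1 by rewrite ge_min lexx.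
have e2D : e2 * (bnorm D + 1) <= e / 2.
  rewrite -ler_pdivlMr; last by lra.
  by rewrite ge_min; apply/orP; right; rewrite invfM mulrA.
have e1p : e1 * (p + 1) = e / 2.
  by rewrite /e1 invfM mulrA divfK // gt_eqF //; lra.
set n := normc (g u - g v) in h1 h3; set m := normc _ in h2 h3 *.
have a : e1 * n <= e1 * ((p + 1) * x).
  apply: ler_wpM2l; first exact: ltW.
  by rewrite (le_trans h3) //; have := ler_wpM2r x0 e21; move: h2; lra.
have b : m * bnorm D <= e2 * x * bnorm D by rewrite ler_wpM2r.
have c : e2 * (bnorm D + 1) * x <= e / 2 * x by rewrite ler_wpM2r.
have c' : 0 <= e2 * x by rewrite mulr_ge0 // ltW.
rewrite mulrA e1p in a; move: h1; lra.
Qed.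

End strict_differentiability.

Section arcs.
Variable R : realType.
Implicit Types (f : R -> R) (g : R -> R[i]).

Lemma C1_01_cont f : C1_01 f -> forall t, 0 <= t <= 1 -> forall e, 0 < e ->
  exists2 d, 0 < d & forall u, 0 <= u <= 1 -> `|u - t| < d ->
    `|derive1 f u - derive1 f t| < e.
Proof.
move=> [_ fc] t t01 e e0.
have /subspace_continuousP/(_ t) := fc; rewrite /= in_itv /= => /(_ t01).
move=> /cvgrPdist_lt/(_ e e0); rewrite near_withinE => -[d /= d0 df].
exists d => // u u01 ut; rewrite distrC; apply: df => //=.
by rewrite distrC.
Qed.

(** The mean value theorem for real functions turns continuity of the derivative into the two-point
    estimate; arcs inherit it by coordinates. *)
Lemma C1_01_strict f : C1_01 f -> forall t, 0 <= t <= 1 -> forall e, 0 < e ->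
  exists2 d, 0 < d & forall u v, 0 <= u <= 1 -> 0 <= v <= 1 ->
    `|u - t| < d -> `|v - t| < d ->
    `|f u - f v - (u - v) * derive1 f t| <= e * `|u - v|.
Proof.
move=> fC t t01 e e0; have [d d0 df] := C1_01_cont fC t01 e0.
exists d => // u v u01 v01 ut vt; wlog uv : u v u01 v01 ut vt / v <= u.
  move=> W; case: (leP v u) => [/W|/ltW/W]; first exact.
  move=> /(_ v01 u01 vt ut); rewrite -normrN opprB [in X in _ <= X]distrC.
  by congr (`|_| <= _); ring.
have in01 x : x \in `[v, u] -> 0 <= x <= 1.
  by rewrite in_itv /=; move: u01 v01; lra.
have [f1 f2] := fC.
have [||c cuv ->] := @MVT_segment R f (derive1 f) v u uv.
- move=> x xuv; rewrite derive1E; apply: DeriveDef => //.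
  apply: f1; rewrite in_itv /=; apply: in01.
  by move: xuv; rewrite !in_itv /=; lra.
- apply: derivable_within_continuous => x /in01 x01.
  by apply: f1; rewrite in_itv.
- rewrite mulrC -mulrBr normrM mulrC ler_wpM2r //.
  apply/ltW/df; first exact: in01.
  by move: cuv ut vt; rewrite in_itv /= !ltr_norml; lra.
Qed.

Lemma arc_velocity_cont g : C1_arc g -> cont01 (velocity g : R -> R[i]^o).
Proof.
move=> [gr gi] t t01 e e0; have e2 : 0 < e / 2 by lra.
have [d d0 dr] := C1_01_cont gr t01 e2.
have [d' d'0 di] := C1_01_cont gi t01 e2.
exists (Num.min d d') => [|u u01]; rewrite ?lt_min ?d0 // => /andP[ud ud'].
apply: le_lt_trans (normc_le_ReIm _) _; rewrite /= [e]splitr.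
by apply: ltrD; [exact: dr | exact: di].
Qed.

Lemma arc_strict_deriv g : C1_arc g ->
  strict_deriv01 (g : R -> R[i]^o) (velocity g : R -> R[i]^o).
Proof.
move=> [gr gi] t t01 e e0; have e2 : 0 < e / 2 by lra.
have [d d0 dr] := C1_01_strict gr t01 e2.
have [d' d'0 di] := C1_01_strict gi t01 e2.
exists (Num.min d d') => [|u v u01 v01]; rewrite ?lt_min ?d0 //.
move=> /andP[ud ud'] /andP[vd vd'].
apply: le_trans (normc_le_ReIm _) _.
have -> : g u - g v - (u - v)%:C * velocity g t =
   (complex.Re (g u) - complex.Re (g v) - (u - v) * derive1 (fun t => complex.Re (g t)) t)
   +i* (complex.Im (g u) - complex.Im (g v) - (u - v) * derive1 (fun t => complex.Im (g t)) t).
  by rewrite /velocity; case: (g u) (g v) => ? ? [? ?] /=; congr (_ +i* _); ring.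
have := dr u v u01 v01 ud vd; have := di u v u01 v01 ud' vd'; rewrite /=; lra.
Qed.

Lemma arc_cont g : C1_arc g -> cont01 (g : R -> R[i]^o).
Proof.
move=> gC t t01 e e0; have [d d0 dg] := arc_strict_deriv gC t01 ltr01.
have p0 : 0 < normc (velocity g t) + 1 by have := normc_ge0 (velocity g t); lra.
exists (Num.min d (e / (normc (velocity g t) + 1))).
  by rewrite lt_min d0 divr_gt0.
move=> u u01; rewrite lt_min ltr_pdivlMr // => /andP[ud ue].
have a : normc (g u - g t - (u - t)%:C * velocity g t) <= 1 * `|u - t|.
  by apply: dg => //; rewrite subrr normr0.
have := le_normcD (g u - g t - (u - t)%:C * velocity g t) ((u - t)%:C * velocity g t).
rewrite subrK Normc.normcM normcR => b; change (normc (g u - g t) < e).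
by move: a b ue; lra.
Qed.

End arcs.

(** * Liouville's theorem *)

Section liouville.
Variables (R : realType) (A : banachAlgType R).
Implicit Types (t u v r d e : R).

Definition cis t : R[i] := cos (2 * pi * t) +i* sin (2 * pi * t).

Definition circle (c : R[i]) r t : R[i] := c + r%:C * cis t.

Lemma normc_cis t : normc (cis t) = 1.
Proof. by rewrite /cis /= cos2Dsin2 sqrtr1. Qed.

Lemma normc_circle c r t : normc (circle c r t - c) = `|r|.
Proof. by rewrite /circle addrAC subrr add0r Normc.normcM normc_cis normcR mulr1. Qed.

Lemma circle01 c r : circle c r 1 = circle c r 0.
Proof.
rewrite /circle /cis mulr1 mulr0 cos0 sin0 (_ : 2 * pi = pi *+ 2).
  by rewrite cos2pi sin2pi.
by rewrite mulr_natl.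
Qed.

Lemma circle_Re_deriv c r t : is_derive t 1
  (fun t => complex.Re (circle c r t)) (- (2 * pi * r * sin (2 * pi * t))).
Proof.
have -> : (fun t => complex.Re (circle c r t)) =
    (fun t => complex.Re c + r * cos (2 * pi * t)).
  by apply/funext => u; rewrite /circle /=; case: c => c1 c2 /=; rewrite !mul0r subr0.
apply: is_derive_eq.
by rewrite /GRing.scale /=; ring.
Qed.

Lemma circle_Im_deriv c r t : is_derive t 1
  (fun t => complex.Im (circle c r t)) (2 * pi * r * cos (2 * pi * t)).
Proof.
have -> : (fun t => complex.Im (circle c r t)) =
    (fun t => complex.Im c + r * sin (2 * pi * t)).
  by apply/funext => u; rewrite /circle /=; case: c => c1 c2 /=; rewrite !mul0r addr0.
apply: is_derive_eq.
by rewrite /GRing.scale /=; ring.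
Qed.

Lemma circle_velocity c r t :
  velocity (circle c r) t = (two_pi_i R * r%:C) * cis t.
Proof.
rewrite /velocity !derive1E.
have [_ ->] := circle_Re_deriv c r t; have [_ ->] := circle_Im_deriv c r t.
by rewrite /two_pi_i /cis; congr (_ +i* _); simpl; ring.
Qed.

Lemma circle_arc c r : C1_arc (circle c r).
Proof.
have contl (h h' : R -> R) (k : R) :
    (forall t, is_derive t 1 h (k * h' (2 * pi * t))) -> continuous h' -> C1_01 h.
  move=> hd hc; split; first by move=> t _; have [] := hd t.
  have -> : derive1 h = (fun t => k * h' (2 * pi * t)).
    by apply/funext => t; rewrite derive1E; have [_ ->] := hd t.
  apply: continuous_subspaceT => t.
  apply: cvgM; first exact: cvg_cst.
  by apply: (@continuous_comp _ _ _ (fun t => 2 * pi * t)); [apply: cvgM; [exact: cvg_cst|exact: cvg_id]|exact: hc].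
split.
- apply: (contl _ sin (- (2 * pi * r))); last exact: continuous_sin.
  by move=> t; rewrite mulNr; exact: circle_Re_deriv.
- apply: (contl _ cos (2 * pi * r)); last exact: continuous_cos.
  by move=> t; exact: circle_Im_deriv.
Qed.

Lemma two_pi_i_neq0 : two_pi_i R != 0.
Proof.
rewrite /two_pi_i eq_complex /= eqxx /=.
by rewrite mulf_neq0 // gt_eqF // pi_gt0.
Qed.

Section entire.
Variables (F F' : R[i] -> A) (z0 : R[i]).
Hypothesis FF : forall z, strict_deriv F z (F' z).

Let F_cont z : cont_at F z. Proof. exact: strict_deriv_cont (FF z). Qed.
Let F'_cont z : cont_at F' z. Proof. exact: strict_deriv_continuous FF z. Qed.
Let circ_cont r : cont01 (circle z0 r : R -> R[i]^o).
Proof. exact: arc_cont (circle_arc _ _). Qed.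

Let mean r := Rint (fun t => F (circle z0 r t)).

Let meanP r : has_Rint (fun t => F (circle z0 r t)) 0 1 (mean r).
Proof. by apply/RintP/(cont01_comp (circ_cont r)) => t _. Qed.

(* The integrand is, up to a nonzero constant, the derivative of the periodic
   function [t |-> F (circle z0 r t)]. *)
Let deriv_mean r : 0 < r ->
  has_Rint (fun t => cis t *: F' (circle z0 r t)) 0 1 0.
Proof.
move=> r0; pose k := two_pi_i R * r%:C.
have k0 : k != 0.
  rewrite mulf_neq0 //; last by rewrite (inj_eq (@complexI R)) gt_eqF.
  exact: two_pi_i_neq0.
have : has_Rint (fun t => velocity (circle z0 r) t *: F' (circle z0 r t)) 0 1
    (F (circle z0 r 1) - F (circle z0 r 0)).
  apply: (@Rint_strict_deriv _ _ (fun t => F (circle z0 r t))).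
    apply: cont01Z (arc_velocity_cont (circle_arc _ _)) _.
    by apply: cont01_comp (circ_cont r) _ => t _.
  exact: strict_deriv01_comp (circ_cont r) (arc_strict_deriv (circle_arc _ _)) _.
rewrite circle01 subrr => /(has_RintZ k^-1); rewrite scaler0.
apply: eq_has_Rint => t _; rewrite circle_velocity -/k scalerA.
by rewrite mulrA mulVf // mul1r.
Qed.

(** The derivative of [mean] in the radius is the integral that [deriv_mean] evaluates to 0;
    [compact01] makes the two-point estimate uniform in the angle. *)
Let mean_locally_flat r0 e : 0 < r0 -> 0 < e -> exists2 d, 0 < d &
  forall r r', `|r - r0| < d -> `|r' - r0| < d ->
    bnorm (mean r - mean r') <= e * `|r - r'|.
Proof.
move=> r00 e0.
have [||d d0 dP] := @compact01 R (fun d t => forall r r',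
    `|r - r0| < d -> `|r' - r0| < d ->
    bnorm (F (circle z0 r t) - F (circle z0 r' t) -
      (r - r')%:C *: (cis t *: F' (circle z0 r0 t))) <= e * `|r - r'|).
- by move=> d d' t _ d'd h r r' rd rd'; apply: h; exact: lt_le_trans d'd.
- move=> t t01; have e2 : 0 < e / 2 by lra.
  have [d d0 dF] := FF (circle z0 r0 t) e2.
  have [d1 d10 dF'] := F'_cont (circle z0 r0 t) e2.
  have m0 : 0 < Num.min d d1 / 2 by rewrite divr_gt0 // lt_min d0.
  have m1 : Num.min d d1 / 2 <= d / 2 by rewrite ler_pM2r ?ge_min ?lexx ?invr_gt0.
  have m2 : Num.min d d1 / 2 <= d1 / 2.
    by rewrite ler_pM2r ?ge_min ?lexx ?orbT ?invr_gt0.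
  have [d2 d20 hc] := circ_cont r0 t01 m0.
  exists (Num.min d2 (Num.min d d1 / 2)) => [|s s01]; rewrite lt_min ?d20 //.
  move=> /andP[/(hc s s01) st _] r r'.
  rewrite !lt_min => /andP[_ r1] /andP[_ r1'].
  have near x : `|x - r0| < Num.min d d1 / 2 ->
      normc (circle z0 x s - circle z0 r0 t) < d.
    move=> x1; rewrite (le_lt_trans (normcB_tri _ (circle z0 r0 s) _)) //.
    have -> : circle z0 x s - circle z0 r0 s = (x - r0)%:C * cis s.
      by rewrite /circle opprD addrACA subrr add0r -mulrBl -rmorphB.
    rewrite Normc.normcM normcR normc_cis mulr1.
    by move: st; rewrite /bnorm /=; move: x1; lra.
  have := dF _ _ (near _ r1) (near _ r1').
  have -> : circle z0 r s - circle z0 r' s = (r - r')%:C * cis s.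
    by rewrite /circle opprD addrACA subrr add0r -mulrBl -rmorphB.
  rewrite Normc.normcM normcR normc_cis mulr1.
  have : bnorm (F' (circle z0 r0 s) - F' (circle z0 r0 t)) < e / 2.
    by apply: dF'; move: st; rewrite /bnorm /=; lra.
  set D := F' (circle z0 r0 t); set D' := F' (circle z0 r0 s) => DD.
  have -> : F (circle z0 r s) - F (circle z0 r' s) - (r - r')%:C *: (cis s *: D') =
    F (circle z0 r s) - F (circle z0 r' s) - ((r - r')%:C * cis s) *: D
    - ((r - r')%:C * cis s) *: (D' - D).
    by rewrite scalerBr opprB addrA subrK scalerA.
  move=> h; rewrite (le_trans (bnormB _ _)) // bnormZ Normc.normcM normcR normc_cis mulr1.
  by have := ler_wpM2l (normr_ge0 (r - r')) (ltW DD); move: h; lra.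
- exists d => // r r' rd rd'.
  have h : has_Rint (fun t => F (circle z0 r t) - F (circle z0 r' t) -
      (r - r')%:C *: (cis t *: F' (circle z0 r0 t))) 0 1 (mean r - mean r').
    rewrite -[mean r - _]subr0 -(scaler0 _ (r - r')%:C).
    by apply: has_RintB; [exact: has_RintB | apply: has_RintZ; exact: deriv_mean].
  by apply: has_Rint_le h _ => t t01; exact: dP.
Qed.

Let mean_cst r1 r2 : 0 < r1 -> r1 <= r2 -> mean r2 = mean r1.
Proof.
(* The radii are parametrized by [0, 1], so that [Rint_strict_deriv] applies with derivative 0. The
   [D + 1] below covers [r1 = r2]. *)
move=> r10 r12; pose G s := mean (r1 + s * (r2 - r1)).
have : has_Rint (fun=> 0) 0 1 (G 1 - G 0).
  apply: Rint_strict_deriv; first exact: cont01_cst.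
  move=> t t01 e e0; set D := r2 - r1; have D0 : 0 <= D by rewrite /D; lra.
  have D1 : 0 < D + 1 by lra.
  have [||d d0 dP] := @mean_locally_flat (r1 + t * D) (e / (D + 1)).
  - have : 0 <= t * D by rewrite mulr_ge0 //; lra.
    lra.
  - by rewrite divr_gt0.
  exists (d / (D + 1)) => [|u v _ _]; first by rewrite divr_gt0.
  rewrite !ltr_pdivlMr // scaler0 subr0 => ut vt.
  have aff x y : r1 + x * D - (r1 + y * D) = (x - y) * D by ring.
  apply: le_trans (dP _ _ _ _) _; rewrite ?aff ?normrM ?(ger0_norm D0).
  - by apply: le_lt_trans ut; rewrite ler_wpM2l //; lra.
  - by apply: le_lt_trans vt; rewrite ler_wpM2l //; lra.
  - rewrite mulrAC ler_pdivrMr //.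
    by have := mulr_ge0 (ltW e0) (normr_ge0 (u - v)); lra.
move=> /has_Rint_unique/(_ (has_Rint_cst 0))/subr0_eq.
by rewrite /G mul1r mul0r addr0 addrC subrK.
Qed.

(** The mean over circles about [z0] is near [F z0] for small radii, near 0 for large ones, and
    independent of the radius. *)
Lemma liouville0 : (forall e, 0 < e -> exists M, forall z, M < normc z ->
    bnorm (F z) <= e) -> F z0 = 0.
Proof.
move=> F0; apply: bnorm_small => e e0; have e2 : 0 < e / 2 by lra.
have [d d0 dF] := F_cont z0 e2; have [M MF] := F0 _ e2.
have h1 : bnorm (mean (d / 2) - F z0) <= e / 2.
  apply: has_Rint_le (has_RintB (meanP (d / 2)) (has_Rint_cst (F z0))) _ => t _.
  by apply/ltW/dF; rewrite normc_circle ger0_norm; lra.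
(* Every point of this circle has modulus above [M], and the radius is at least [d / 2], as
   [mean_cst] requires. *)
pose r := Num.max (d / 2) (M + normc z0 + 1).
have dr : d / 2 <= r by rewrite le_max lexx.
have Mr : M + normc z0 + 1 <= r by rewrite le_max lexx orbT.
have h2 : bnorm (mean r) <= e / 2.
  apply: has_Rint_le (meanP r) _ => t _; apply: MF.
  have := le_normcD (circle z0 r t) (- z0); rewrite normc_circle normcN.
  by rewrite ger0_norm; lra.
rewrite (@mean_cst (d / 2)) // in h2; last by lra.
have := bnorm_tri (F z0) (mean (d / 2)) 0; rewrite !subr0 bnormBC.
by move: h1 h2; lra.
Qed.

End entire.

End liouville.

(** * Contour integrals *)

Section contour_integrals.
Variable R : realType.
Implicit Types (gs : seq (R -> R[i])) (z w u v : R[i]).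

Definition trace gs z := exists g t, [/\ g \in gs, 0 <= t <= 1 & z = g t].

(** The second condition says that starting points and end points agree with multiplicity, in the
    form in which it is used: increments cancel. The order of the arcs and their grouping into
    curves are forgotten. *)
Definition closed_chain gs := (forall g, g \in gs -> C1_arc g) /\
  forall F : R[i] -> R[i], \sum_(g <- gs) (F (g 1) - F (g 0)) = 0.

Section algebra_valued.
Variable A : banachAlgType R.
Implicit Types (f h : R[i] -> A).

Definition trace_cont gs f := forall g, g \in gs -> cont01 (fun t => f (g t)).

Definition cint gs f : A :=
  \sum_(g <- gs) Rint (fun t => velocity g t *: f (g t)).

Lemma eq_Rint (f h : R -> A) : (forall t, 0 <= t <= 1 -> f t = h t) ->
  Rint f = Rint h.
Proof.
move=> fh; congr xget; apply/eq_set => I; apply/propeqP.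
by split; apply: eq_has_Rint => t t01; rewrite fh.
Qed.

Lemma eq_cint gs f h : (forall z, trace gs z -> f z = h z) -> cint gs f = cint gs h.
Proof.
move=> fh; rewrite /cint big_seq [RHS]big_seq; apply: eq_bigr => g gG.
by apply: eq_Rint => t t01; rewrite fh //; exists g, t.
Qed.

Lemma trace_bounded gs f : trace_cont gs f ->
  exists2 M, 0 < M & forall z, trace gs z -> bnorm (f z) <= M.
Proof.
elim: gs => [|g gs IH] fc; first by exists 1 => // z [g [t []]].
have [M M0 fM] := IH (fun g' g'G => fc g' (mem_behead (s := g :: gs) g'G)).
have [N N0 fN] := cont01_bounded (fc g (mem_head _ _)).
exists (M + N) => [|z [g' [t [+ t01 ->]]]]; first by lra.
rewrite inE => /orP[/eqP ->|g'G]; first by have := fN t t01; lra.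
by apply: le_trans (fM _ _) _; [exists g', t | lra].
Qed.

Section arcs.
Variable gs : seq (R -> R[i]).
Hypothesis gsC : forall g, g \in gs -> C1_arc g.

Lemma arc_has_Rint f g : trace_cont gs f -> g \in gs ->
  has_Rint (fun t => velocity g t *: f (g t)) 0 1
    (Rint (fun t => velocity g t *: f (g t))).
Proof.
move=> fc gG; apply/RintP/(cont01Z (arc_velocity_cont (gsC gG))); exact: fc.
Qed.

Let cint_ext (f h : R[i] -> A) (L : A -> A) : (forall x y, L (x + y) = L x + L y) ->
  L 0 = 0 ->
  (forall g, g \in gs -> has_Rint (fun t => velocity g t *: h (g t)) 0 1
     (L (Rint (fun t => velocity g t *: f (g t))))) ->
  cint gs h = L (cint gs f).
Proof.
move=> LD L0 hL; rewrite /cint (big_morph L LD L0) big_seq [RHS]big_seq.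
by apply: eq_bigr => g gG; exact/RintE/hL.
Qed.

Lemma cint_mull f x : trace_cont gs f ->
  cint gs (fun z => x * f z) = x * cint gs f.
Proof.
move=> fc; apply: (cint_ext (L := fun y => x * y)) => [y z||g gG].
- by rewrite mulrDr.
- by rewrite mulr0.
apply: eq_has_Rint (has_Rint_mull x (arc_has_Rint fc gG)) => t _.
by rewrite scalerAr.
Qed.

Lemma cint_mulr f x : trace_cont gs f ->
  cint gs (fun z => f z * x) = cint gs f * x.
Proof.
move=> fc; apply: (cint_ext (L := fun y => y * x)) => [y z||g gG].
- by rewrite mulrDl.
- by rewrite mul0r.
apply: eq_has_Rint (has_Rint_mulr x (arc_has_Rint fc gG)) => t _.
by rewrite scalerAl.
Qed.

Lemma cintZ f k : trace_cont gs f ->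
  cint gs (fun z => k *: f z) = k *: cint gs f.
Proof.
move=> fc; apply: (cint_ext (L := fun y => k *: y)) => [y z||g gG].
- by rewrite scalerDr.
- by rewrite scaler0.
apply: eq_has_Rint (has_RintZ k (arc_has_Rint fc gG)) => t _.
by rewrite !scalerA mulrC.
Qed.

Lemma cintB f h : trace_cont gs f -> trace_cont gs h ->
  cint gs (fun z => f z - h z) = cint gs f - cint gs h.
Proof.
move=> fc hc; rewrite /cint -sumrB big_seq [RHS]big_seq.
apply: eq_bigr => g gG; apply: RintE.
apply: eq_has_Rint (has_RintB (arc_has_Rint fc gG) (arc_has_Rint hc gG)) => t _.
by rewrite scalerBr.
Qed.

Lemma cint_alg (k : R[i] -> R[i]^o) :
  (forall g, g \in gs -> cont01 (fun t => k (g t))) ->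
  cint gs (fun z => (k z)%:A) =
  (\sum_(g <- gs) Rint (fun t => velocity g t *: k (g t) : R[i]^o))%:A.
Proof.
move=> kc; rewrite scaler_suml /cint big_seq [RHS]big_seq.
apply: eq_bigr => g gG; apply: RintE.
have : has_Rint (fun t => velocity g t *: k (g t) : R[i]^o) 0 1
    (Rint (fun t => velocity g t *: k (g t) : R[i]^o)).
  by apply/RintP/(cont01Z (arc_velocity_cont (gsC gG)))/kc.
by move/(has_Rint_alg A); apply: eq_has_Rint => t _; rewrite scalerA.
Qed.

End arcs.

Lemma cint_le gs : (forall g, g \in gs -> C1_arc g) ->
  exists2 C, 0 < C & forall f M, 0 <= M -> trace_cont gs f ->
    (forall z, trace gs z -> bnorm (f z) <= M) -> bnorm (cint gs f) <= C * M.
Proof.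
elim: gs => [|g gs IH] gsC.
  by exists 1 => // f M M0 _ _; rewrite /cint big_nil bnorm0 mul1r.
have mg : g \in g :: gs := mem_head _ _.
have [C C0 hC] := IH (fun g' g'G => gsC g' (mem_behead (s := g :: gs) g'G)).
have [V V0 gV] := cont01_bounded (arc_velocity_cont (gsC g mg)).
exists (V + C) => [|f M M0 fc fM]; first by lra.
rewrite /cint big_cons (le_trans (bnormD _ _)) // mulrDl lerD //.
  apply: has_Rint_le (arc_has_Rint gsC fc mg) _ => t t01.
  rewrite bnormZ ler_pM ?normc_ge0 ?bnorm_ge0 //; first exact: gV.
  by apply: fM; exists g, t.
apply: hC => // [g' g'G|z [g' [t [g'G t01 ->]]]].
  by apply: fc; rewrite inE g'G orbT.
by apply: fM; exists g', t; rewrite inE g'G orbT.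
Qed.

End algebra_valued.

(** The distance to the trace is bounded below by the reciprocal of a bound for the continuous
    function [(z - w)^-1]. *)
Lemma trace_away gs w : (forall g, g \in gs -> C1_arc g) -> ~ trace gs w ->
  trace_cont gs (fun z => (z - w)^-1 : R[i]^o) /\
  exists2 d, 0 < d & forall z, trace gs z -> d <= normc (z - w).
Proof.
move=> gsC wG.
have nz z : trace gs z -> z - w != 0.
  by move=> zG; rewrite subr_eq0; apply: contra_notN wG => /eqP <-.
have c : trace_cont gs (fun z => (z - w)^-1 : R[i]^o).
  move=> g gG; apply: (@cont01V _ _ (fun t => g t - w : R[i]^o)).
    by apply: cont01B; [exact: arc_cont (gsC _ gG) | exact: cont01_cst].
  by move=> t t01; rewrite unitfE nz //; exists g, t.
split=> //; have [M M0 hM] := trace_bounded c.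
exists M^-1 => [|z zG]; first by rewrite invr_gt0.
have := hM z zG; rewrite /bnorm /= Normc.normcV.
by rewrite -[X in _ <= X]invrK lef_pV2 ?posrE ?invr_gt0 // normc_gt0 // nz.
Qed.

Lemma closed_chain_deriv gs (F f : R[i] -> R[i]^o) : closed_chain gs ->
  trace_cont gs f -> (forall z, trace gs z -> strict_deriv F z (f z)) ->
  cint gs f = 0.
Proof.
move=> [gsC gs0] fc Ff; rewrite -(gs0 F) /cint big_seq [RHS]big_seq.
apply: eq_bigr => g gG; apply: RintE.
apply: (@Rint_strict_deriv _ R[i]^o (fun t => F (g t))).
  exact: cont01Z (arc_velocity_cont (gsC _ gG)) (fc g gG).
apply: strict_deriv01_comp (arc_cont (gsC _ gG)) (arc_strict_deriv (gsC _ gG)) _.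
by move=> t t01; apply: Ff; exists g, t.
Qed.

Section cauchy_transform.
Variables (A : banachAlgType R) (gs : seq (R -> R[i])) (h : R[i] -> A).
Hypothesis gsC : forall g, g \in gs -> C1_arc g.
Hypothesis hc : trace_cont gs h.

Definition cauchy_transform w : A := cint gs (fun z => (z - w)^-1 *: h z).

Lemma cauchy_kernel_cont w : ~ trace gs w ->
  trace_cont gs (fun z => (z - w)^-1 *: h z).
Proof.
move=> wG g gG; have [c _] := trace_away gsC wG.
exact: (@cont01Z _ _ (fun t => (g t - w)^-1)) (c g gG) (hc gG).
Qed.

(** Differentiation under the integral sign, by an explicit estimate of the kernel that is uniform
    on the trace. *)
Lemma cauchy_transform_deriv w : ~ trace gs w ->
  strict_deriv cauchy_transform w (cint gs (fun z => (z - w) ^- 2 *: h z)).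
Proof.
move=> wG e e0; have [c [d d0 dG]] := trace_away gsC wG.
have [C C0 hC] := cint_le A gsC; have [M M0 hM] := trace_bounded hc.
have d3 : 0 < d ^+ 3 by rewrite exprn_gt0.
(* Points within [d / 2] of [w] keep distance [d / 2] from the trace; the second entry makes the
   kernel remainder, at most [8 * r / d ^+ 3] times [normc (u - v)], integrate to at most
   [e * normc (u - v)]. *)
pose r := Num.min (d / 2) (e * d ^+ 3 / (8 * C * M)).
have CM : 0 < 8 * C * M by rewrite !mulr_gt0.
have r0 : 0 < r by rewrite lt_min !divr_gt0 ?mulr_gt0.
have rd : r <= d / 2 by rewrite ge_min lexx.
have re : 8 * C * M * r <= e * d ^+ 3.
  by rewrite mulrC -ler_pdivlMr // ge_min lexx orbT.
have away u : normc (u - w) < r -> forall z, trace gs z -> d / 2 <= normc (z - u).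
  move=> ur z /dG h1; have := normcB_tri z u w; lra.
have off u : normc (u - w) < r -> ~ trace gs u.
  by move=> ur /(away u ur); rewrite subrr Normc.normc0; lra.
exists r => // u v ur vr.
have c2 : trace_cont gs (fun z => (z - w) ^- 2 *: h z).
  move=> g gG; apply: (@cont01Z _ _ (fun t => (g t - w) ^- 2)) (hc gG).
  apply: eq_cont01 (cont01M (c g gG) (c g gG)) => t _.
  by rewrite expr2 invfM.
rewrite /cauchy_transform -cintB //; try exact/cauchy_kernel_cont/off.
rewrite -cintZ // -cintB //; last first.
- by move=> g gG; apply: cont01Z (cont01_cst _) (c2 g gG).
- by move=> g gG; apply: cont01B; [exact: cauchy_kernel_cont (off u ur) g gG
     | exact: cauchy_kernel_cont (off v vr) g gG].
apply: le_trans (_ : C * (normc (u - v) * (8 * r / d ^+ 3) * M) <= _); last first.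
  have -> : C * (normc (u - v) * (8 * r / d ^+ 3) * M) =
     normc (u - v) * (8 * C * M * r / d ^+ 3) by ring.
  by rewrite mulrC ler_wpM2r ?normc_ge0 // ler_pdivrMr.
apply: hC.
- by rewrite !mulr_ge0 ?normc_ge0 ?ltW // invr_gt0.
- move=> g gG; apply: cont01B; last by apply: cont01Z (cont01_cst _) (c2 g gG).
  by apply: cont01B; [exact: cauchy_kernel_cont (off u ur) g gG
     | exact: cauchy_kernel_cont (off v vr) g gG].
- move=> z zG; rewrite scalerA -!scalerBl bnormZ.
  apply: ler_pM; rewrite ?normc_ge0 ?bnorm_ge0 ?hM //.
  have zu := away u ur z zG; have zv := away v vr z zG; have zw := dG z zG.
  have nz (x : R) : 0 < x -> forall y : R[i], x <= normc y -> y != 0.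
    by move=> x0 y; apply: contraTneq => ->; rewrite Normc.normc0 -ltNge.
  have d2 : 0 < d / 2 by lra.
  have pu := nz _ d2 _ zu; have pv := nz _ d2 _ zv; have pw := nz _ d0 _ zw.
  (* Exact remainder of the kernel: the two fractions are at most [4 * r / d ^+ 3] and
     [2 * r / d ^+ 3]. *)
  have -> : (z - u)^-1 - (z - v)^-1 - (u - v) * (z - w) ^- 2 =
     (u - v) * ((u - w) / ((z - u) * (z - v) * (z - w)) +
                (v - w) / ((z - v) * (z - w) * (z - w))).
    by field; rewrite pu pv pw.
  rewrite Normc.normcM ler_wpM2l ?normc_ge0 //.
  rewrite (le_trans (le_normcD _ _)) //.
  rewrite !Normc.normcM !Normc.normcV !Normc.normcM.
  have fr (a p q : R) : 0 <= a < r -> 0 < p -> p <= q -> a / q <= r / p.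
    move=> /andP[a0 ar] p0 pq; have q0 := lt_le_trans p0 pq.
    by rewrite ler_pM ?invr_ge0 ?(ltW ar) ?(ltW q0) // lef_pV2.
  have dd : 0 < d / 2 * (d / 2) by rewrite mulr_gt0.
  have dw := normc_ge0 (z - w).
  apply: le_trans (lerD (fr _ (d / 2 * (d / 2) * d) _ _ _ _)
    (fr _ (d / 2 * d * d) _ _ _ _)) _.
  - by rewrite normc_ge0.
  - by rewrite mulr_gt0.
  - by rewrite !ler_pM ?mulr_ge0 // ?ltW.
  - by rewrite normc_ge0.
  - by rewrite !mulr_gt0.
  - by rewrite !ler_pM ?mulr_ge0 // ?ltW.
  - have -> : r / (d / 2 * (d / 2) * d) + r / (d / 2 * d * d) = 6 * r / d ^+ 3.
      by field; rewrite gt_eqF.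
    by rewrite ler_wpM2r ?invr_ge0 ?(ltW d3) //; move: r0; lra.
Qed.

End cauchy_transform.

End contour_integrals.

(** * Resolvents and winding numbers *)

Section resolvents.
Variables (R : realType) (A : banachAlgType R) (a : A).
Implicit Types (z w u v : R[i]) (d e : R) (b : A).

Definition resolvent z : A := (z%:A - a)^-1.

Lemma notin_spectrum w : ~ spectrum a w -> w%:A - a \is a GRing.unit.
Proof. by move=> /negP; rewrite negbK. Qed.

Lemma algBr z w : (z - w)%:A = z%:A - w%:A :> A.
Proof. exact: scalerBl. Qed.

Lemma bnorm_alg z : bnorm (z%:A : A) = normc z.
Proof. by rewrite bnormZ bnorm1 mulr1. Qed.

Lemma resolvent_near w : ~ spectrum a w -> exists2 d, 0 < d & forall u,
  normc (u - w) < d ->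
  ~ spectrum a u /\ bnorm (resolvent u) <= 2 * bnorm (resolvent w).
Proof.
move=> /notin_spectrum/unit_near[d d0 dP]; exists d => // u ud.
have [|h1 h2] := dP (u%:A - a); first by rewrite opprB addrA subrK -algBr bnorm_alg.
by split=> //; apply/negP; rewrite negbK.
Qed.

Lemma resolvent_comm b z : b * a = a * b -> b * resolvent z = resolvent z * b.
Proof.
move=> ba; apply: commrV; apply: commrB; last exact: ba.
exact/esym/scalar_comm.
Qed.

Lemma resolventB u v : ~ spectrum a u -> ~ spectrum a v ->
  resolvent u - resolvent v = (v - u) *: (resolvent u * resolvent v).
Proof.
move=> /notin_spectrum uu /notin_spectrum uv.
have -> : (v - u) *: (resolvent u * resolvent v) =
    resolvent u * ((v%:A - a) - (u%:A - a)) * resolvent v.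
  by rewrite opprB addrA subrK -algBr mulr_algr scalerAl.
by rewrite mulrBr mulVr // mulrBl mul1r -mulrA divrr // mulr1.
Qed.

Lemma resolvent_deriv w : ~ spectrum a w ->
  strict_deriv resolvent w (- (resolvent w * resolvent w)).
Proof.
move=> wa e e0; have [d d0 dP] := resolvent_near wa.
set m := bnorm (resolvent w) in dP; have m0 : 0 <= m := bnorm_ge0 _.
(* The remainder consists of two triple products of resolvents, bounded by [2 * m ^+ 3] and
   [4 * m ^+ 3]. *)
pose K := 6 * m ^+ 3 + 1; have K0 : 0 < K by rewrite ltr_wpDl // mulr_ge0 // exprn_ge0.
have eK : 0 < e / K by rewrite divr_gt0.
exists (Num.min d (e / K)) => [|u v]; rewrite ?lt_min ?d0 //.
move=> /andP[/dP[ua um] ue] /andP[/dP[va vm] ve].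
rewrite resolventB // -[v - u]opprB scaleNr scalerN opprK addrC -scalerBr bnormZ mulrC.
rewrite ler_wpM2r ?normc_ge0 //.
have -> : resolvent w * resolvent w - resolvent u * resolvent v =
   (u - w) *: (resolvent w * resolvent u * resolvent w) +
   (v - w) *: (resolvent u * resolvent w * resolvent v).
  rewrite -(mulrA (resolvent u)) (scalerAr (v - w)) (scalerAl (u - w)).
  by rewrite -!resolventB // mulrBl mulrBr addrA subrK.
have b3 (x y z : A) p q r : bnorm x <= p -> bnorm y <= q -> bnorm z <= r ->
    bnorm (x * y * z) <= p * q * r.
  move=> xp yq zr; rewrite (le_trans (bnormM _ _)) // ler_pM ?bnorm_ge0 //.
  by rewrite (le_trans (bnormM _ _)) // ler_pM ?bnorm_ge0.
rewrite (le_trans (bnormD _ _)) // !bnormZ.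
have h1 := b3 _ _ _ _ _ _ (lexx m) um (lexx m).
have h2 := b3 _ _ _ _ _ _ um (lexx m) vm.
have := ler_pM (normc_ge0 _) (bnorm_ge0 _) (ltW ue) h1.
have := ler_pM (normc_ge0 _) (bnorm_ge0 _) (ltW ve) h2.
set x := normc (u - w) * _; set y := normc (v - w) * _ => hy hx.
have : x + y <= e / K * (6 * m ^+ 3) by move: hx hy; lra.
have : e / K * (6 * m ^+ 3) <= e / K * K by rewrite ler_wpM2l ?ltW // /K; lra.
by rewrite divfK ?gt_eqF //; lra.
Qed.

(** Invertibility is the Neumann series; from [z * resolvent z = 1 + a * resolvent z] one gets
    [(|z| - |a|) |resolvent z| <= 1]. *)
Lemma resolvent_infty e : 0 < e -> exists M, forall z, M < normc z ->
  ~ spectrum a z /\ bnorm (resolvent z) <= e.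
Proof.
move=> e0; have a0 := bnorm_ge0 a.
exists (bnorm a + e^-1) => z zM; have ei : 0 < e^-1 by rewrite invr_gt0.
have nz0 : 0 < normc z by lra.
have z0 : z != 0 by apply: contraTneq nz0 => ->; rewrite Normc.normc0 ltxx.
have uz : z%:A - a \is a GRing.unit.
  have -> : z%:A - a = z%:A * (1 - z^-1 *: a).
    by rewrite mulr_algl scalerBr scalerA divff // scale1r.
  rewrite unitrMl; last first.
    apply: neumann; rewrite bnormZ Normc.normcV mulrC ltr_pdivrMr // mul1r.
    by lra.
  by apply/unitrP; exists (z^-1)%:A; rewrite !mulr_algl !scalerA mulVf ?divff ?scale1r.
split; first by apply/negP; rewrite negbK.
have : normc z * bnorm (resolvent z) <= 1 + bnorm a * bnorm (resolvent z).
  rewrite -bnormZ -(@bnorm1 _ A) -mulr_algl -[z%:A](subrK a) mulrDl divrr //.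
  by rewrite (le_trans (bnormD _ _)) // lerD2l bnormM.
have r0 := bnorm_ge0 (resolvent z); set r := bnorm _ in r0 * => h.
have : e^-1 * r <= 1.
  by have : 0 <= (normc z - bnorm a - e^-1) * r; [apply: mulr_ge0 => //; lra|lra].
by rewrite mulrC ler_pdivrMr // mul1r.
Qed.

End resolvents.

Section winding_numbers.
Variable R : realType.
Implicit Types (gs : seq (R -> R[i])) (z w u v : R[i]).

(** The winding number times [2 pi i], on the same scale as [winds_once]. *)
Definition winding gs w : R[i]^o := cint gs (fun z => (z - w)^-1 : R[i]^o).

Lemma windingE gs w : winding gs w = cint gs (fun z => (z - w)^-1 : R[i]^o).
Proof. by []. Qed.

(** In the Banach algebra [R[i]^o] the function [(z - w)^-1] is a resolvent, so results on
    resolvents cover it. *)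
Lemma scalar_spectrum w z : ~ spectrum (w : R[i]^o) z <-> z != w.
Proof.
rewrite /spectrum /= -subr_eq0 -unitfE.
have -> : z%:A - (w : R[i]^o) = z - w by rewrite /GRing.scale /= mulr1.
by split => [/negP|h]; [|apply/negP]; rewrite negbK.
Qed.

(** The derivative is the integral of [(z - w) ^- 2], which has the primitive [- (z - w)^-1] and
    thus integrates to 0 over a closed chain. *)
Lemma winding_deriv gs w : closed_chain gs -> ~ trace gs w ->
  strict_deriv (winding gs) w 0.
Proof.
move=> gsC wG; have [arcs _] := gsC.
have [c _] := trace_away arcs wG.
have c1 : trace_cont gs (fun=> 1 : R[i]^o) by move=> g _; exact: cont01_cst.
have -> : winding gs = cauchy_transform gs (fun=> 1 : R[i]^o).
  by apply/funext => u; apply: eq_cint => z _; rewrite /GRing.scale /= mulr1.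
suff <- : cint gs (fun z => (z - w) ^- 2 *: (1 : R[i]^o)) = 0.
  exact: cauchy_transform_deriv.
apply: (@closed_chain_deriv _ _ (fun z => - resolvent (w : R[i]^o) z)) => //.
  move=> g gG; apply: eq_cont01 (cont01M (c g gG) (c g gG)) => t _.
  by rewrite /GRing.scale /= mulr1 expr2 invfM.
move=> z zG.
have -> : (z - w) ^- 2 *: (1 : R[i]^o) =
    - - (resolvent (w : R[i]^o) z * resolvent (w : R[i]^o) z).
  by rewrite opprK /resolvent /GRing.scale /= !mulr1 expr2 invfM.
apply: strict_derivN; apply: resolvent_deriv; apply/scalar_spectrum.
by apply: contra_notN wG => /eqP <-.
Qed.

(** Straight segments suffice: to nearby points, to the centre of a circle, and leftwards to
    infinity. *)
Lemma winding_segment gs w0 w1 : closed_chain gs ->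
  (forall s : R, 0 <= s <= 1 -> ~ trace gs (w0 + s%:C * (w1 - w0))) ->
  winding gs w0 = winding gs w1.
Proof.
move=> gsC off; pose g (s : R) : R[i]^o := w0 + s%:C * (w1 - w0).
have gB s t : g s - g t = (s - t)%:C * (w1 - w0).
  by rewrite /g opprD addrACA subrr add0r -mulrBl -rmorphB.
have gd : strict_deriv01 g (fun=> w1 - w0 : R[i]^o).
  move=> t _ e e0; exists 1 => // u v _ _ _ _.
  rewrite gB subrr bnorm0 mulr_ge0 ?normr_ge0 // ltW //.
have gc : cont01 g.
  move=> t _ e e0; have n1 : 0 < normc (w1 - w0) + 1.
    by have := normc_ge0 (w1 - w0); lra.
  exists (e / (normc (w1 - w0) + 1)) => [|u _]; first by rewrite divr_gt0.
  rewrite ltr_pdivlMr // gB => h; change (normc ((u - t)%:C * (w1 - w0)) < e).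
  by rewrite Normc.normcM normcR; have := normr_ge0 (u - t); move: h; lra.
have : has_Rint (fun t => (w1 - w0 : R[i]) *: (0 : R[i]^o)) 0 1
    (winding gs (g 1) - winding gs (g 0)).
  apply: (@Rint_strict_deriv _ _ (fun t => winding gs (g t))); first exact: cont01_cst.
  apply: (strict_deriv01_comp (F' := fun=> 0) gc gd) => t t01.
  exact: winding_deriv gsC (off t t01).
have -> : g 1 = w1 by rewrite /g mul1r addrC subrK.
have -> : g 0 = w0 by rewrite /g mul0r addr0.
rewrite scaler0 => /has_Rint_unique/(_ (has_Rint_cst 0))/subr0_eq; exact: esym.
Qed.

Lemma winding_near gs w : closed_chain gs -> ~ trace gs w ->
  exists2 d, 0 < d & forall u, normc (u - w) < d ->
    ~ trace gs u /\ winding gs u = winding gs w.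
Proof.
move=> gsC wG; have [_ [d d0 dG]] := trace_away gsC.1 wG.
exists d; first exact: d0.
move=> u ud; have off (s : R) : 0 <= s <= 1 ->
    ~ trace gs (w + s%:C * (u - w)).
  move=> s01 /dG; rewrite addrAC subrr add0r Normc.normcM normcR ger0_norm; last by lra.
  by have := normc_ge0 (u - w); nra.
split; last exact: esym (winding_segment gsC off).
by have := off 1; rewrite mul1r addrC subrK; apply; rewrite ler01 lexx.
Qed.

(** Moving [w] to the left never meets the trace, and the integrand tends to 0. *)
Lemma winding_left gs w : closed_chain gs ->
  (forall z, trace gs z -> right_half_plane z) -> complex.Re w <= 0 ->
  winding gs w = 0.
Proof.
move=> gsC GH w0.
have off (s : R) : 0 <= s -> ~ trace gs (w - s%:C).
  move=> s0 /GH; rewrite /right_half_plane /=; move: w0.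
  by case: w => x y /=; lra.
have [M M0 hM] : exists2 M, 0 < M & forall z, trace gs z -> normc (z - w) <= M.
  apply: (@trace_bounded _ R[i]^o gs (fun z => z - w)) => g gG.
  by apply: cont01B; [exact: arc_cont (gsC.1 _ gG) | exact: cont01_cst].
have [C C0 hC] := cint_le R[i]^o gsC.1.
apply: (@bnorm_small _ R[i]^o) => e e0.
have Ce : 0 < C / e by rewrite divr_gt0.
(* At [w - s] the trace is at distance at least [C / e], so the integral is at most
   [C * (e / C)]. *)
pose s := M + C / e; have s0 : 0 <= s by rewrite /s; lra.
have -> : winding gs w = winding gs (w - s%:C).
  apply: winding_segment => // t t01.
  have -> : w + t%:C * (w - s%:C - w) = w - (t * s)%:C.
    by rewrite addrAC subrr add0r mulrN -rmorphM.
  by apply: off; rewrite mulr_ge0 //; lra.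
have [c _] := trace_away gsC.1 (off s s0).
have eC : 0 <= e / C by rewrite divr_ge0 // ltW.
apply: le_trans (hC _ (e / C) eC c _) _.
  move=> z zG; change (normc (z - (w - s%:C))^-1 <= e / C).
  have := normcB_tri (z - (w - s%:C)) (z - w) 0.
  have h : C / e <= normc (z - (w - s%:C)).
    have -> : z - (w - s%:C) = (z - w) + s%:C by rewrite opprB addrCA addrC.
    have := le_normcD ((z - w) + s%:C) (- (z - w)).
    rewrite addrAC subrr add0r normcN normcR ger0_norm //.
    by have := hM z zG; rewrite /s; lra.
  move=> _; rewrite Normc.normcV -[e / C]invrK invfM invrK mulrC.
  by rewrite lef_pV2 ?posrE // (lt_le_trans Ce).
by rewrite mulrC divfK // gt_eqF.
Qed.

Lemma circle_chain (c : R[i]) (r : R) : closed_chain [:: circle c r].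
Proof.
split=> [g|F]; first by rewrite inE => /eqP ->; exact: circle_arc.
by rewrite big_seq1 circle01 subrr.
Qed.

Lemma trace_circle (c : R[i]) (r : R) z : 0 < r -> trace [:: circle c r] z ->
  normc (z - c) = r.
Proof.
move=> r0 [g [t [+ _ ->]]]; rewrite inE => /eqP ->.
by rewrite normc_circle gtr0_norm.
Qed.

(** The segment from [w] to the centre avoids the circle, and at the centre the integrand is
    constant. *)
Lemma winding_circle (c : R[i]) (r : R) w : normc (w - c) < r ->
  winding [:: circle c r] w = two_pi_i R.
Proof.
move=> wr; have r0 : 0 < r := le_lt_trans (normc_ge0 _) wr.
have -> : winding [:: circle c r] w = winding [:: circle c r] c.
  apply: winding_segment; first exact: circle_chain.
  move=> s s01 /(trace_circle r0).
  have -> : w + s%:C * (c - w) - c = (1 - s)%:C * (w - c).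
    by rewrite rmorphB /=; ring.
  rewrite Normc.normcM normcR ger0_norm; last by lra.
  by have := normc_ge0 (w - c); nra.
rewrite /winding /cint big_seq1; apply: RintE.
apply: eq_has_Rint (has_Rint_cst (two_pi_i R : R[i]^o)) => t _.
have -> : circle c r t - c = r%:C * cis t by rewrite /circle addrAC subrr add0r.
rewrite circle_velocity -mulrA; apply/esym/mulfK; rewrite mulf_neq0 //.
  by rewrite (inj_eq (@complexI R)) gt_eqF.
by apply: contraTneq (ltr01 : 0 < (1 : R)) => h; rewrite -(normc_cis t) h Normc.normc0 ltxx.
Qed.

Lemma cint_winding (A : banachAlgType R) gs w : closed_chain gs -> ~ trace gs w ->
  cint gs (fun z => ((z - w)^-1)%:A : A) = (winding gs w)%:A.
Proof.
move=> gsC wG; have [c _] := trace_away gsC.1 wG.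
exact: (cint_alg A gsC.1 c).
Qed.

End winding_numbers.

(* Otherwise unification unfolds winding numbers down to Riemann sums. *)
Opaque winding.

(** * Products of Riesz integrals *)

Section riesz_integrals.
Variables (R : realType) (A : banachAlgType R) (a : A).
Implicit Types (gs : seq (R -> R[i])) (z w u v : R[i]) (b : A).

(** The factor [1 / (2 pi i)] is left out, to match [winding]. *)
Definition riesz gs : A := cint gs (resolvent a).

Definition avoids_spectrum gs := forall z, trace gs z -> ~ spectrum a z.

Lemma resolvent_trace_cont gs : closed_chain gs -> avoids_spectrum gs ->
  trace_cont gs (resolvent a).
Proof.
move=> [arcs _] off g gG; apply: cont01_comp (arc_cont (arcs g gG)) _ => t t01.
by apply/strict_deriv_cont/resolvent_deriv/off; exists g, t.
Qed.

Lemma cint_comm gs (f : R[i] -> A) b : (forall g, g \in gs -> C1_arc g) ->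
  trace_cont gs f -> (forall z, b * f z = f z * b) ->
  b * cint gs f = cint gs f * b.
Proof.
move=> arcs fc bf; rewrite -cint_mull // -cint_mulr //.
by apply: eq_cint => z _.
Qed.

Variable gs : seq (R -> R[i]).
Hypotheses (gsC : closed_chain gs) (off : avoids_spectrum gs).
Let rc := resolvent_trace_cont gsC off.

Lemma riesz_comm b : b * a = a * b -> b * riesz gs = riesz gs * b.
Proof. by move=> ba; apply: cint_comm gsC.1 rc _ => z; exact: resolvent_comm. Qed.

Local Notation D := (cauchy_transform gs (resolvent a)).

Lemma cauchy_comm w b : ~ trace gs w -> b * a = a * b -> b * D w = D w * b.
Proof.
move=> wG ba; apply: cint_comm gsC.1 (cauchy_kernel_cont gsC.1 rc wG) _ => z.
by rewrite -scalerAr -scalerAl resolvent_comm.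
Qed.

(** Pointwise on the trace, [w - a = (z - a) - (z - w)] turns the integrand into
    [(z - w)^-1 - resolvent a z]. The point [w] itself may lie in the spectrum. *)
Lemma cauchy_resolvent w : ~ trace gs w ->
  (w%:A - a) * D w = (winding gs w)%:A - riesz gs.
Proof.
move=> wG; have [c _] := trace_away gsC.1 wG.
have kc := cauchy_kernel_cont gsC.1 rc wG.
rewrite -(cint_mull gsC.1 _ kc) -(cint_winding A gsC wG).
rewrite /riesz -(cintB gsC.1 _ rc); last first.
  by move=> g gG; exact: cont01_alg (c g gG).
apply: eq_cint => z zG; have za := notin_spectrum (off zG).
have zw : z - w != 0 by rewrite subr_eq0; apply: contra_notN wG => /eqP <-.
rewrite -scalerAr.
have -> : w%:A - a = (z%:A - a) - (z - w)%:A.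
  by rewrite algBr opprB [RHS]addrC subrKA.
by rewrite mulrBl divrr // mulr_algl scalerBr scalerA mulVf // scale1r.
Qed.

Lemma cauchy_resolvent' w : ~ trace gs w ->
  D w * (w%:A - a) = (winding gs w)%:A - riesz gs.
Proof.
move=> wG; rewrite -cauchy_resolvent // !(mulrBl, mulrBr).
by rewrite (cauchy_comm wG (erefl (a * a))) mulr_algl mulr_algr.
Qed.

End riesz_integrals.

Section riesz_product.
Variables (R : realType) (A : banachAlgType R) (a : A).
Variables (gs gs' : seq (R -> R[i])) (m m' : R[i]).
Hypotheses (gsC : closed_chain gs) (gsC' : closed_chain gs').
Hypotheses (off : avoids_spectrum a gs) (off' : avoids_spectrum a gs').
Hypothesis wind : forall w, spectrum a w -> winding gs w = m \/ winding gs' w = m'.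

Local Notation rho := (resolvent a).
Let D := cauchy_transform gs rho.
Let D' := cauchy_transform gs' rho.
Let P := riesz a gs - m%:A.
Let P' := riesz a gs' - m'%:A.

Let DP w : ~ trace gs w -> winding gs w = m -> D w * (w%:A - a) = - P.
Proof. by move=> wG wm; rewrite /D cauchy_resolvent' // wm opprB. Qed.

Let DP' w : ~ trace gs' w -> winding gs' w = m' -> (w%:A - a) * D' w = - P'.
Proof. by move=> wG wm; rewrite /D' cauchy_resolvent // wm opprB. Qed.

Let rhoP' w : rho w * P' = P' * rho w.
Proof.
rewrite /P' mulrBl mulrBr -scalar_comm; congr (_ - _).
by apply: riesz_comm => //; exact/esym/resolvent_comm.
Qed.

(* Off the spectrum this is [P * P' * rho]; the two other branches extend it
   across the spectrum, and agree wherever both apply. *)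
Let F w : A := if `[< ~ spectrum a w >] then P * P' * rho w
  else if `[< winding gs w = m >] then - (D w * P') else - (P * D' w).

Let FE1 w : ~ trace gs w -> winding gs w = m -> F w = - (D w * P').
Proof.
move=> wG wm; rewrite /F; case: asboolP => [wa|_]; last by rewrite asboolT.
have uw := notin_spectrum wa.
have -> : P = - (D w * (w%:A - a)) by rewrite DP // opprK.
by rewrite -mulrA -rhoP' !mulNr mulrA mulrK.
Qed.

(** At a spectral point where both alternatives hold, the two branches agree because both equal
    [D w * (w - a) * D' w]. *)
Let FE2 w : ~ trace gs' w -> winding gs' w = m' -> F w = - (P * D' w).
Proof.
move=> wG wm; rewrite /F; case: asboolP => [wa|/contrapT wa].
  have -> : D' w = - (rho w * P').
    have uw := notin_spectrum wa.
    by rewrite -mulrN -(DP' wG wm) mulKr.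
  by rewrite mulrN opprK -mulrA rhoP'.
case: asboolP => // wm1; have wG1 : ~ trace gs w by move=> /off.
have -> : P' = - ((w%:A - a) * D' w) by rewrite DP' // opprK.
have -> : P = - (D w * (w%:A - a)) by rewrite DP // opprK.
by rewrite mulrN mulNr mulrA.
Qed.

(** One of the three formulas holds on a whole neighbourhood of [w]: the resolvent set is open, and
    winding numbers are locally constant off the trace. *)
Let F_deriv w : exists d, strict_deriv F w d.
Proof.
have [wa|wa] := pselect (spectrum a w); last first.
  have [d d0 dP] := resolvent_near wa.
  exists (P * P' * - (rho w * rho w)).
  apply: (eq_strict_deriv_near d0) (strict_deriv_mull (P * P') (resolvent_deriv wa)).
  by move=> u /dP[ua _]; rewrite /F asboolT.
have [wm|wm] := wind wa.
- have wG : ~ trace gs w by move=> /off.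
  have [d d0 dP] := winding_near gsC wG.
  have h := cauchy_transform_deriv gsC.1 (resolvent_trace_cont gsC off) wG.
  eexists; apply: (eq_strict_deriv_near d0) (strict_derivN (strict_deriv_mulr P' h)).
  by move=> u /dP[uG um]; rewrite (FE1 uG (etrans um wm)).
- have wG : ~ trace gs' w by move=> /off'.
  have [d d0 dP] := winding_near gsC' wG.
  have h := cauchy_transform_deriv gsC'.1 (resolvent_trace_cont gsC' off') wG.
  eexists; apply: (eq_strict_deriv_near d0) (strict_derivN (strict_deriv_mull P h)).
  by move=> u /dP[uG um]; rewrite (FE2 uG (etrans um wm)).
Qed.

(** Once [F] vanishes identically, any point outside the spectrum gives
    [P * P' = F z * (z - a) = 0]. *)
Lemma riesz_product : (riesz a gs - m%:A) * (riesz a gs' - m'%:A) = 0.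
Proof.
have [F' FF'] := choice F_deriv.
have q1 : 0 < bnorm (P * P') + 1 by have := bnorm_ge0 (P * P'); lra.
have F0 z : F z = 0.
  apply: (liouville0 z FF') => e e0.
  have [M hM] := resolvent_infty a (divr_gt0 e0 q1).
  exists M => {}z /hM[za zb]; rewrite /F asboolT // (le_trans (bnormM _ _)) //.
  have : bnorm (rho z) * (bnorm (P * P') + 1) <= e by rewrite -ler_pdivlMr.
  by have := bnorm_ge0 (rho z); lra.
have [M hM] := resolvent_infty a ltr01.
(* A point beyond [M], hence outside the spectrum; the absolute value allows for negative [M]. *)
pose z : R[i] := (`|M| + 1)%:C.
have [|za _] := hM z.
  by rewrite normcR ger0_norm ?addr_ge0 //; have := ler_norm M; lra.
have := F0 z; rewrite /F asboolT // => h; have uz := notin_spectrum za.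
rewrite -[LHS](divrK uz); change (P * P' * rho z * (z%:A - a) = 0).
by rewrite h mul0r.
Qed.

End riesz_product.

Section riesz_consequences.
Variables (R : realType) (A : banachAlgType R) (a : A).
Implicit Types gs : seq (R -> R[i]).

(** The product formula against the empty chain with [m' = 1], whose factor is [-1]. *)
Lemma riesz_winding gs m : closed_chain gs -> avoids_spectrum a gs ->
  (forall w, spectrum a w -> winding gs w = m) -> riesz a gs = m%:A.
Proof.
move=> gsC off wm.
have nilC : closed_chain ([::] : seq (R -> R[i])).
  by split => [//|F]; rewrite big_nil.
have nil_off : avoids_spectrum a [::] by move=> z [g [t []]].
have := riesz_product (m' := 1) gsC nilC off nil_off (fun w wa => or_introl (wm w wa)).
rewrite [riesz a [::]](_ : _ = 0); last by rewrite /riesz /cint big_nil.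
rewrite sub0r scale1r mulrN1 => /eqP; rewrite oppr_eq0 subr_eq0 => /eqP.
exact.
Qed.

End riesz_consequences.

(** * Contours around the spectrum *)

Section spectral_chains.
Variable R : realType.
Implicit Types (gs : seq (R -> R[i])) (z w u v : R[i]) (d e : R).

Section gap.
Variables (A : banachAlgType R) (a : A).
Hypothesis a_im : spectrum a `&` imaginary_axis = set0.

Lemma spectrum_Re_neq0 w : spectrum a w -> complex.Re w != 0.
Proof.
move=> wa; apply/eqP => w0.
have : (spectrum a `&` imaginary_axis) w by split.
by rewrite a_im.
Qed.

Lemma spectrum_bounded : exists2 M : R, 0 < M & forall w, spectrum a w -> normc w <= M.
Proof.
have [M hM] := resolvent_infty a ltr01.
exists (`|M| + 1) => [|w wa]; first by have := normr_ge0 M; lra.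
rewrite leNgt; apply/negP => h; have [] := hM w _ => //.
by have := ler_norm M; lra.
Qed.

(** Compactness is applied not to the spectrum but to the segment of the imaginary axis from [-iM]
    to [iM], around which the open resolvent set contains a strip. *)
Lemma spectrum_gap : exists2 d, 0 < d & forall w, spectrum a w ->
  d <= `|complex.Re w|.
Proof.
have [M M0 hM] := spectrum_bounded.
have [||d d0 dP] := @compact01 R (fun d t => forall x, `|x| < d ->
    ~ spectrum a (x +i* (M * (2 * t - 1)))).
- by move=> d d' t _ d'd h x xd; apply: h; exact: lt_le_trans d'd.
- move=> t t01; pose w0 : R[i] := 0 +i* (M * (2 * t - 1)).
  have [|d d0 dP] := @resolvent_near _ _ a w0.
    by move=> /spectrum_Re_neq0; rewrite eqxx.
  have M1 : 0 < 1 + 2 * M by lra.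
  (* The distance to [w0] is at most [|x| + 2 * M * |s - t|]. *)
  exists (d / (1 + 2 * M)) => [|s s01]; first by rewrite divr_gt0.
  rewrite ltr_pdivlMr // => st x; rewrite ltr_pdivlMr // => xd.
  apply: (proj1 (dP _ _)); apply: le_lt_trans (normc_le_ReIm _) _.
  rewrite /= subr0 (_ : _ - _ = 2 * M * (s - t)); last by ring.
  rewrite normrM ger0_norm; last by lra.
  move: st xd; set p := `|x|; set q := `|s - t|.
  have : 0 <= p := normr_ge0 _; have : 0 <= q := normr_ge0 _.
  nra.
exists d => // w wa; rewrite leNgt; apply/negP => wd.
have wM : `|complex.Im w| <= M := le_trans (normc_ge_Im w) (hM w wa).
(* The parameter at which the segment has imaginary part [complex.Im w]; it lies in [0, 1] as
   [|Im w| <= M]. *)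
apply: (dP ((complex.Im w / M + 1) / 2) _ _ wd).
  have : -1 <= complex.Im w / M <= 1.
    by rewrite -ler_norml normrM normfV (gtr0_norm M0) ler_pdivrMr // mul1r.
  lra.
have -> : M * (2 * ((complex.Im w / M + 1) / 2) - 1) = complex.Im w.
  by field; rewrite gt_eqF.
by move: wa; case: (w).
Qed.

Lemma enclosing_circle : exists c r : R, [/\ 0 < r, r < c &
  forall w, spectrum a w -> right_half_plane w -> normc (w - c%:C) < r].
Proof.
have [d d0 hd] := spectrum_gap; have [M M0 hM] := spectrum_bounded.
have Md : 0 < M ^+ 2 / d by rewrite divr_gt0 // exprn_gt0.
(* For [|w| <= M] and [Re w >= d], [|w - c|^2 <= M^2 - 2 c d + c^2], which is below [(c - d / 2)^2]
   as soon as [M^2 < c d + d^2 / 4]; here [c d = M^2 + d^2]. *)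
pose c := M ^+ 2 / d + d.
have cd : c * d = M ^+ 2 + d ^+ 2 by rewrite /c mulrDl divfK // gt_eqF.
exists c, (c - d / 2); split; rewrite /c; try lra.
rewrite -/c; have c0 : 0 < c by rewrite /c; lra.
have r0 : 0 < c - d / 2 by rewrite /c; lra.
move=> w wa wH; have := hd w wa; have := hM w wa; move: wH.
rewrite /right_half_plane /=; case: w {wa} => x y /= x0 wM.
rewrite gtr0_norm // => dx.
have wM2 : x ^+ 2 + y ^+ 2 <= M ^+ 2.
  by rewrite -[leLHS]sqr_sqrtr ?addr_ge0 ?sqr_ge0 // ler_pXn2r ?nnegrE ?sqrtr_ge0 ?(ltW M0).
rewrite -(gtr0_norm r0) -sqrtr_sqr ltr_sqrt ?exprn_gt0 // subr0.
have : d * c <= x * c by rewrite ler_wpM2r // ltW.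
move: cd wM2; rewrite !expr2; nra.
Qed.

End gap.

(** What remains of a [spectral_contour] after flattening. *)
Definition spectral_chain (A : banachAlgType R) (a : A) gs :=
  [/\ closed_chain gs, forall z, trace gs z -> right_half_plane z,
      avoids_spectrum a gs &
      forall w, spectrum a w -> right_half_plane w -> winding gs w = two_pi_i R].

Lemma circle_spectral_chain (A : banachAlgType R) (a : A) (c r : R) :
  0 < r -> r < c ->
  (forall w, spectrum a w -> right_half_plane w -> normc (w - c%:C) < r) ->
  spectral_chain a [:: circle c%:C r].
Proof.
move=> r0 rc hw; have GH z : trace [:: circle c%:C r] z -> right_half_plane z.
  move=> /(trace_circle r0) zr; have := Defs.normc_ge_Re (z - c%:C).
  rewrite zr /right_half_plane /=; case: z {zr} => x y /=.
  by rewrite ler_norml; lra.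
split=> //; first exact: circle_chain.
- by move=> z zG /hw/(_ (GH z zG)); rewrite (trace_circle r0 zG) ltxx.
- by move=> w wa wH; apply: winding_circle; exact: hw.
Qed.

Lemma exists_spectral_chain (A : banachAlgType R) (a : A) :
  spectrum a `&` imaginary_axis = set0 ->
  exists c r : R, [/\ 0 < r, r < c & spectral_chain a [:: circle c%:C r]].
Proof.
move=> /enclosing_circle[c [r [r0 rc hw]]]; exists c, r; split=> //.
exact: circle_spectral_chain.
Qed.

Section comparison.
Variables (A : banachAlgType R) (a : A).

Lemma spectral_chain_left gs w : spectral_chain a gs -> complex.Re w <= 0 ->
  winding gs w = 0.
Proof. by case=> gsC GH _ _ w0; exact: winding_left gsC GH w0. Qed.

(** [riesz_product] with [m = 2 pi i] and [m' = 0]: spectral points on the right satisfy the first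
    alternative, the others the second. In [riesz_mul'] the two values are exchanged, and comparing
    the results shows that the integral does not depend on the chain. *)
Lemma riesz_mul gs gs' : spectral_chain a gs -> spectral_chain a gs' ->
  riesz a gs * riesz a gs' = two_pi_i R *: riesz a gs'.
Proof.
move=> G G'; have [gsC GH off wind] := G; have [gsC' GH' off' wind'] := G'.
have := @riesz_product _ _ a gs gs' (two_pi_i R) 0 gsC gsC' off off'.
rewrite scale0r subr0 mulrBl mulr_algl => h; apply/subr0_eq/h => w wa.
have [w0|wH] := leP (complex.Re w) 0; last by left; exact: wind.
by right; exact: spectral_chain_left w0.
Qed.

Lemma riesz_mul' gs gs' : spectral_chain a gs -> spectral_chain a gs' ->
  riesz a gs * riesz a gs' = two_pi_i R *: riesz a gs.
Proof.
move=> G G'; have [gsC GH off wind] := G; have [gsC' GH' off' wind'] := G'.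
have := @riesz_product _ _ a gs gs' 0 (two_pi_i R) gsC gsC' off off'.
rewrite scale0r subr0 mulrBr mulr_algr => h; apply/subr0_eq/h => w wa.
have [w0|wH] := leP (complex.Re w) 0; last by right; exact: wind'.
by left; exact: spectral_chain_left w0.
Qed.

Lemma riesz_eq gs gs' : spectral_chain a gs -> spectral_chain a gs' ->
  riesz a gs = riesz a gs'.
Proof.
move=> G G'; apply: (scalerI (two_pi_i_neq0 R)).
by rewrite -(riesz_mul' G G') riesz_mul.
Qed.

End comparison.

Lemma spectrumN (A : banachAlgType R) (y : A) z : spectrum (- y) z <-> spectrum y (- z).
Proof.
rewrite /spectrum /= opprK -[X in _ <-> is_true (X \isn't a _)]opprK.
by rewrite unitrN opprB scaleNr opprK addrC.
Qed.

(* Sylvester-Rosenblum: integrating [(z - y)^-1 h = h (z + y')^-1] along a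
   contour around the spectrum of [y] gives [2 pi i h = 0]. *)
Lemma sylvester_eq0 (A : banachAlgType R) (y y' h : A) :
  spectrum y `<=` right_half_plane -> spectrum y' `<=` right_half_plane ->
  y * h = - (h * y') -> h = 0.
Proof.
move=> yH y'H yh.
have [|c [r [r0 rc [gsC GH off wind]]]] := @exists_spectral_chain _ y.
  rewrite -subset0 => w [/yH]; rewrite /right_half_plane /imaginary_axis /= => + w0.
  by rewrite w0 ltxx.
set gs := [:: _] in gsC GH off wind.
have left w : spectrum (- y') w -> complex.Re w < 0.
  by move=> /spectrumN/y'H; rewrite /right_half_plane; case: w => ? ? /=; lra.
have off' : avoids_spectrum (- y') gs.
  by move=> z /GH zH /left; move: zH; rewrite /right_half_plane /=; lra.
(* The circle winds once about each spectral point of [y] and not at all about those of [- y'], so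
   [riesz_winding] evaluates both integrals. *)
have Iy : riesz y gs = (two_pi_i R)%:A.
  by apply: riesz_winding => // w wa; apply: wind => //; exact: yH.
have Iy' : riesz (- y') gs = 0%:A.
  by apply: riesz_winding => // w /left w0; apply: winding_left gsC GH (ltW w0).
have : riesz y gs * h = h * riesz (- y') gs.
  rewrite /riesz -(cint_mulr gsC.1 _ (resolvent_trace_cont gsC off)).
  rewrite -(cint_mull gsC.1 _ (resolvent_trace_cont gsC off')).
  apply: eq_cint => z zG.
  have uz := notin_spectrum (off z zG); have uz' := notin_spectrum (off' z zG).
  apply: (mulrI uz); rewrite mulrA divrr // mul1r.
  have -> : (z%:A - y) * (h * resolvent (- y') z) =
      ((z%:A - y) * h) * resolvent (- y') z by rewrite mulrA.
  have -> : (z%:A - y) * h = h * (z%:A - - y').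
    by rewrite mulrBl mulrBr yh mulrN mulr_algl mulr_algr.
  by rewrite mulrK.
rewrite Iy Iy' scale0r mulr0 mulr_algl => /eqP.
by rewrite scaler_eq0 (negbTE (two_pi_i_neq0 R)) => /eqP.
Qed.

(** The two roots are not known to commute, so the difference of squares cannot be factored; the
    Sylvester equation for [y - y'] holds regardless. *)
Lemma sqrt_unique (A : banachAlgType R) (y y' : A) : y * y = y' * y' ->
  spectrum y `<=` right_half_plane -> spectrum y' `<=` right_half_plane -> y = y'.
Proof.
move=> yy yH y'H; apply/subr0_eq/(sylvester_eq0 yH y'H).
by rewrite mulrBr mulrBl yy opprB.
Qed.

Lemma principal_sqrtE (A : banachAlgType R) (x y : A) : y * y = x ->
  spectrum y `<=` right_half_plane -> principal_sqrt x = y.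
Proof.
move=> yx yH; rewrite /principal_sqrt; case: xgetP => [y' _ /= [y'x y'H]|/(_ y)[]//].
by apply: sqrt_unique => //; rewrite yx.
Qed.

End spectral_chains.

(** * The sign function *)

Section sign_function.
Variables (R : realType) (A : banachAlgType R).
Implicit Types (a b v x y : A) (z w : R[i]).

Lemma bicommutantP a b :
  bicommutant a b <-> forall x, x * a = a * x -> b * x = x * b.
Proof.
split=> h x xa; apply: h; first by move=> _ ->.
exact: xa.
Qed.

Lemma spectrum_unit a : ~ spectrum a 0 -> a \is a GRing.unit.
Proof. by move=> /notin_spectrum; rewrite scale0r sub0r unitrN. Qed.

Lemma notin_spectrumP a z x : (z%:A - a) * x = 1 -> x * (z%:A - a) = 1 ->
  ~ spectrum a z.
Proof. by move=> ax xa; apply/negP; rewrite negbK; apply/unitrP; exists x. Qed.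

Section construction.
Variables (a : A) (gs : seq (R -> R[i])).
Hypothesis a_im : spectrum a `&` imaginary_axis = set0.
Hypothesis G : spectral_chain a gs.

Let E : A := (two_pi_i R)^-1 *: riesz a gs.
Let F : A := 1 - E.

Let EE : E * E = E.
Proof.
have [gsC GH off wind] := G.
rewrite /E -scalerAl -scalerAr (riesz_mul G G) !scalerA.
by rewrite -mulrA mulVf ?mulr1 // two_pi_i_neq0.
Qed.

Let FF : F * F = F.
Proof. by rewrite /F mulrBl mul1r mulrBr mulr1 EE subrr subr0. Qed.

Let EF : E * F = 0. Proof. by rewrite /F mulrBr mulr1 EE subrr. Qed.
Let FE : F * E = 0. Proof. by rewrite /F mulrBl mul1r EE subrr. Qed.
Let EDF : E + F = 1. Proof. by rewrite addrC subrK. Qed.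

Let E_comm b : b * a = a * b -> b * E = E * b.
Proof.
have [gsC GH off wind] := G.
by move=> ba; rewrite /E -scalerAr -scalerAl riesz_comm.
Qed.

Let F_comm b : b * a = a * b -> b * F = F * b.
Proof. by move=> ba; rewrite /F mulrBr mulrBl E_comm // mul1r mulr1. Qed.

(** Here the winding number is 0, so the Cauchy transform inverts [w - a] up to minus the Riesz
    integral. Commutation is recorded in order to obtain two-sided inverses later. *)
Let inv_E w : complex.Re w <= 0 -> exists2 X,
  (forall b, b * a = a * b -> b * X = X * b) & (w%:A - a) * X = E.
Proof.
have [gsC GH off wind] := G => w0.
have wG : ~ trace gs w by move=> /GH; rewrite /right_half_plane /=; lra.
exists (- (two_pi_i R)^-1 *: cauchy_transform gs (resolvent a) w).
  by move=> b ba; rewrite -scalerAr -scalerAl cauchy_comm.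
rewrite -scalerAr cauchy_resolvent // (spectral_chain_left G w0) scale0r sub0r.
by rewrite scalerN scaleNr opprK.
Qed.

(** On the spectrum the winding number is [2 pi i] and the Cauchy transform serves. Elsewhere [w]
    may lie on the chain or have an unknown winding number, but the resolvent is available. *)
Let inv_F w : 0 <= complex.Re w -> exists2 X,
  (forall b, b * a = a * b -> b * X = X * b) & (w%:A - a) * X = F.
Proof.
have [gsC GH off wind] := G => w0.
have [wa|wa] := pselect (spectrum a w).
  have wG : ~ trace gs w by move=> /off.
  have wH : right_half_plane w.
    by rewrite /right_half_plane /= lt_neqAle w0 andbT eq_sym (spectrum_Re_neq0 a_im).
  exists ((two_pi_i R)^-1 *: cauchy_transform gs (resolvent a) w).
    by move=> b ba; rewrite -scalerAr -scalerAl cauchy_comm.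
  rewrite -scalerAr cauchy_resolvent // (wind w wa wH) scalerBr scalerA.
  by rewrite mulVf ?scale1r // two_pi_i_neq0.
exists (resolvent a w * F).
  by move=> b ba; rewrite mulrA resolvent_comm // -mulrA F_comm // mulrA.
by rewrite mulrA divrr ?mul1r //; exact: notin_spectrum.
Qed.

Let S : A := E - F.
Let N : A := a * S.

Let SmulE : S * E = E. Proof. by rewrite /S mulrBl EE FE subr0. Qed.
Let SmulF : S * F = - F. Proof. by rewrite /S mulrBl EF FF sub0r. Qed.

Let SS : S * S = 1.
Proof. by rewrite {2}/S mulrBr SmulE SmulF opprK EDF. Qed.

Let S_comm b : b * a = a * b -> b * S = S * b.
Proof. by move=> ba; rewrite /S mulrBr mulrBl E_comm // F_comm. Qed.

Let NN : N * N = a ^+ 2.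
Proof. by rewrite /N -mulrA (mulrA S) -(S_comm (erefl (a * a))) -mulrA SS mulr1 expr2. Qed.

(** [N] acts as [a] on the range of [E] and as [- a] on that of [F]. Hence for [Re w <= 0] the
    element [w - N] is inverted piecewise, by [inv_E] at [w] and [inv_F] at [- w]. *)
Let N_spectrum : spectrum N `<=` right_half_plane.
Proof.
move=> w wN; rewrite /right_half_plane /= ltNge; apply/negP => w0.
have [X1 X1c X1E] := inv_E w0.
have [|X2 X2c X2F] := inv_F (w := - w).
  by move: w0; case: (w) => ? ? /=; lra.
have Na : N * a = a * N by rewrite /N -mulrA -(S_comm (erefl (a * a))).
have wE : (w%:A - N) * E = E * (w%:A - a).
  rewrite mulrBl mulrBr scalar_comm /N -mulrA SmulE.
  by rewrite (E_comm (erefl (a * a))).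
have wF : (w%:A - N) * F = - (F * ((- w)%:A - a)).
  rewrite mulrBl scalar_comm /N -mulrA SmulF mulrN opprK.
  by rewrite (F_comm (erefl (a * a))) scaleNr -opprD mulrN opprK [RHS]mulrDr.
have mulw b : b * a = a * b -> b * (w%:A - N) = (w%:A - N) * b.
  by move=> ba; rewrite mulrBr mulrBl scalar_comm /N mulrA ba -!mulrA S_comm.
(* The two partial inverses glued together; the minus sign compensates the one in [wF]. *)
pose Z := E * X1 - F * X2.
have Z1 : (w%:A - N) * Z = 1.
  rewrite /Z mulrBr !mulrA wE wF mulNr opprK -!mulrA X1E X2F EE FF.
  exact: EDF.
(* Applied to [w - N], this makes the right inverse [Z] two-sided. *)
have ZW W : W * a = a * W -> Z * W = W * Z.
  move=> Wa; rewrite /Z [RHS]mulrBr [LHS]mulrBl !mulrA (E_comm Wa) (F_comm Wa).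
  by rewrite -!mulrA (X1c _ Wa) (X2c _ Wa).
apply: (notin_spectrumP Z1) wN; rewrite -[RHS]Z1 ZW //.
by rewrite mulrBl mulrBr scalar_comm Na.
Qed.

Lemma principal_sqrt_chain : principal_sqrt (a ^+ 2) = N.
Proof. by apply: principal_sqrtE; [exact: NN | exact: N_spectrum]. Qed.

Lemma principal_sqrt_sqr : principal_sqrt (a ^+ 2) * principal_sqrt (a ^+ 2) = a ^+ 2.
Proof. by rewrite principal_sqrt_chain NN. Qed.

Lemma principal_sqrt_comm : principal_sqrt (a ^+ 2) * a = a * principal_sqrt (a ^+ 2).
Proof. by rewrite principal_sqrt_chain /N -mulrA -(S_comm (erefl (a * a))). Qed.

Lemma spectrum_principal_sqrt :
  spectrum (principal_sqrt (a ^+ 2)) `<=` right_half_plane.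
Proof. by rewrite principal_sqrt_chain. Qed.

Let SE : S = E + E - 1. Proof. by rewrite /S /F opprB addrA. Qed.

Let a_unit : a \is a GRing.unit.
Proof.
apply: spectrum_unit => a0.
by have := spectrum_Re_neq0 a_im a0; rewrite eqxx.
Qed.

Lemma sign_chain : sign a = E + E - 1.
Proof.
rewrite /sign principal_sqrt_chain.
have [uS SV] := invrP SS SS.
by rewrite -SE /N invrM // SV mulrA (S_comm (erefl (a * a))) mulrK.
Qed.

Lemma sign_chain_sqr : sign a ^+ 2 = 1.
Proof.
by rewrite sign_chain -SE expr2.
Qed.

Lemma sign_chain_bicommutant : bicommutant a (sign a).
Proof.
by apply/bicommutantP => x xa; rewrite sign_chain -SE S_comm.
Qed.

Lemma sign_chain_proj : 2^-1 *: (1 + sign a) = (two_pi_i R)^-1 *: riesz a gs.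
Proof.
rewrite sign_chain (_ : 1 + _ = 2%:R *: E); last first.
  by rewrite scaler_nat mulr2n addrC subrK.
by rewrite scalerA mulVf ?scale1r // pnatr_eq0.
Qed.

End construction.

End sign_function.

(** * From contours to closed chains *)

Section contours.
Variables (R : realType) (A : banachAlgType R).
Implicit Types (G : seq (seq (R -> R[i]))) (a : A).

Lemma cycle_sum0 (p : seq (R -> R[i])) (F : R[i] -> R[i]) :
  cycle (fun g h => g 1 == h 0) p -> \sum_(g <- p) (F (g 1) - F (g 0)) = 0.
Proof.
case: p => [|g0 p /=]; first by rewrite big_nil.
rewrite rcons_path => /andP[pp /eqP p1].
have -> : \sum_(g <- g0 :: p) (F (g 1) - F (g 0)) = F (last g0 p 1) - F (g0 0).
  elim: p g0 pp {p1} => [|h p IH] g /=; first by rewrite big_seq1.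
  by move=> /andP[/eqP gh pp]; rewrite big_cons IH // gh addrC subrKA.
by rewrite p1 subrr.
Qed.

Lemma contour_in_closed G (D : set R[i]) : contour_in G D ->
  closed_chain (flatten G) /\ forall z, trace (flatten G) z -> D z.
Proof.
move=> GD; have GP g : g \in flatten G ->
    C1_arc g /\ {in `[0, 1], forall t, D (g t)}.
  by move=> /flattenP[p pG gp]; exact: (GD p pG).2.
split; last first.
  move=> z [g [t [gG t01 ->]]]; apply: (GP g gG).2.
  by rewrite in_itv.
split=> [g /GP[]//|F]; rewrite big_flatten /= big_seq big1 // => p pG.
exact/cycle_sum0/(GD p pG).1.
Qed.

Lemma has_cint_cint G (f : R[i] -> A) : (forall g, g \in flatten G -> C1_arc g) ->
  trace_cont (flatten G) f -> has_cint G f (cint (flatten G) f).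
Proof.
move=> arcs fc; exists (fun g => Rint (fun t => velocity g t *: f (g t))).
by split=> // g gG; exact: (arc_has_Rint arcs fc gG).
Qed.

Lemma has_cintE G (f : R[i] -> A) I : has_cint G f I -> cint (flatten G) f = I.
Proof.
move=> [J [JP ->]]; rewrite /cint big_seq [RHS]big_seq.
by apply: eq_bigr => g /JP/RintE.
Qed.

End contours.

Section spectral_contours.
Variables (R : realType) (A : banachAlgType R).
Implicit Types (G : seq (seq (R -> R[i]))) (a : A).

Lemma winds_once_winding G w : winds_once G w ->
  winding (flatten G) w = two_pi_i R.
Proof. by rewrite windingE => /has_cintE. Qed.

Lemma winding_winds_once G w : (forall g, g \in flatten G -> C1_arc g) ->
  ~ trace (flatten G) w -> winding (flatten G) w = two_pi_i R -> winds_once G w.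
Proof.
move=> arcs wG; rewrite /winds_once windingE => <-.
by have [c _] := trace_away arcs wG; exact: has_cint_cint.
Qed.

Lemma spectral_contour_chain a G : spectral_contour a G ->
  spectral_chain a (flatten G).
Proof.
move=> [/contour_in_closed[gsC GD] Gw]; split=> //.
- by move=> z /GD[].
- by move=> z /GD[].
- by move=> w wa wH; apply: winds_once_winding; exact: Gw.
Qed.

Lemma spectral_contour_circle a (c r : R) : spectral_chain a [:: circle c%:C r] ->
  spectral_contour a [:: [:: circle c%:C r]].
Proof.
move=> [gsC GH off wind]; split.
  move=> p; rewrite inE => /eqP ->; split; first by rewrite /= circle01 eqxx.
  move=> g; rewrite inE => /eqP ->; split; first exact: circle_arc.
  move=> t; rewrite in_itv => t01.
  have tr : trace [:: circle c%:C r] (circle c%:C r t).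
    by exists (circle c%:C r), t; rewrite mem_head.
  by split; [exact: GH | exact: off].
move=> w [wa wH]; apply: winding_winds_once; rewrite ?cats0.
- by move=> g; exact: gsC.1.
- by move=> /off.
- exact: wind.
Qed.

(** The circle shows that admissible contours exist; [riesz_eq] handles all of them. *)
Lemma riesz_spectral_idempotent a gs : spectrum a `&` imaginary_axis = set0 ->
  spectral_chain a gs -> is_spectral_idempotent a ((two_pi_i R)^-1 *: riesz a gs).
Proof.
move=> a_im gsS; split.
  have [c [r [r0 rc cS]]] := exists_spectral_chain a_im.
  by exists [:: [:: circle c%:C r]]; exact: spectral_contour_circle.
move=> G /spectral_contour_chain GS; exists (riesz a (flatten G)).
  have [gsC _ off _] := GS; apply: has_cint_cint; first exact: gsC.1.
  exact: resolvent_trace_cont.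
by rewrite (riesz_eq gsS GS).
Qed.

End spectral_contours.

(** * Transformation rules for the sign *)

Section sign_properties.
Variables (R : realType) (A : banachAlgType R).
Implicit Types (a v y : A) (z : R[i]).

(** Reduces each rule below to exhibiting a square root with spectrum in the half plane. *)
Lemma signE a y : y * y = a ^+ 2 -> spectrum y `<=` right_half_plane ->
  sign a = a * y^-1.
Proof. by move=> yy yH; rewrite /sign (principal_sqrtE yy yH). Qed.

Lemma half_plane_unit y : spectrum y `<=` right_half_plane -> y \is a GRing.unit.
Proof.
by move=> yH; apply: spectrum_unit => /yH; rewrite /right_half_plane /= ltxx.
Qed.

Lemma spectrum_conj y v : v \is a GRing.unit ->
  spectrum (v^-1 * y * v) = spectrum y.
Proof.
move=> uv; apply/seteqP; suff sub z : (z%:A - v^-1 * y * v \is a GRing.unit) =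
    (z%:A - y \is a GRing.unit) by split=> z; rewrite /spectrum /= sub.
have -> : z%:A - v^-1 * y * v = v^-1 * (z%:A - y) * v.
  by rewrite mulrBr mulrBl -scalar_comm -[_ * v^-1 * v]mulrA mulVr // mulr1.
by rewrite unitrMl // unitrMr // unitrV.
Qed.

Lemma spectrumZ y (k : R) : 0 < k -> spectrum y `<=` right_half_plane ->
  spectrum (k%:C *: y) `<=` right_half_plane.
Proof.
move=> k0 yH z; have kC : k%:C != 0 by rewrite (inj_eq (@complexI R)) gt_eqF.
have -> : spectrum (k%:C *: y) z = spectrum y (k%:C^-1 * z).
  rewrite /spectrum /=; congr (is_true (~~ _)).
  have -> : z%:A - k%:C *: y = k%:C%:A * ((k%:C^-1 * z)%:A - y).
    by rewrite mulr_algl scalerBr scalerA mulrA divff // mul1r.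
  rewrite unitrMr //; apply/unitrP; exists k%:C^-1%:A.
  by rewrite !mulr_algl !scalerA mulVf // divff // scale1r.
move=> /yH; rewrite /right_half_plane /= -(@fmorphV _ _ (real_complex R)).
by case: z => x t /=; rewrite mul0r subr0 pmulr_rgt0 // invr_gt0.
Qed.

(** [z - y^-1] equals [z^-1 - y] up to unit factors, and inversion preserves the half plane. *)
Lemma spectrumV y : spectrum y `<=` right_half_plane ->
  spectrum y^-1 `<=` right_half_plane.
Proof.
move=> yH z; have uy := half_plane_unit yH.
have [->|z0] := eqVneq z 0.
  by rewrite /spectrum /= scale0r sub0r unitrN unitrV uy.
have -> : spectrum y^-1 z = spectrum y z^-1.
  rewrite /spectrum /=; congr (is_true (~~ _)).
  have -> : z%:A - y^-1 = - (z%:A * (z^-1%:A - y) * y^-1).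
    rewrite mulrBr mulrBl !mulr_algl scalerA divff // scale1r mul1r.
    by rewrite -scalerAl divrr // opprB.
  rewrite unitrN unitrMl ?unitrV // unitrMr //; apply/unitrP; exists z^-1%:A.
  by rewrite !mulr_algl !scalerA mulVf // divff // scale1r.
move=> /yH; rewrite /right_half_plane /=; move: z0.
case: z => x t /= z0 h; have d0 : 0 < x ^+ 2 + t ^+ 2.
  rewrite lt_neqAle addr_ge0 ?sqr_ge0 // andbT eq_sym paddr_eq0 ?sqr_ge0 //.
  by rewrite !sqrf_eq0; move: z0; rewrite eq_complex.
by move: h; rewrite pmulr_lgt0 // invr_gt0.
Qed.

Section spectrum_off_axis.
Variable a : A.
Hypothesis a_im : spectrum a `&` imaginary_axis = set0.
Let N := principal_sqrt (a ^+ 2).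

Lemma sqrt_sqr : N * N = a ^+ 2.
Proof.
have [c [r [_ _ aS]]] := exists_spectral_chain a_im.
exact: principal_sqrt_sqr a_im aS.
Qed.

Lemma sqrt_half_plane : spectrum N `<=` right_half_plane.
Proof.
have [c [r [_ _ aS]]] := exists_spectral_chain a_im.
exact: spectrum_principal_sqrt a_im aS.
Qed.

Lemma sqrt_unit : N \is a GRing.unit.
Proof. exact/half_plane_unit/sqrt_half_plane. Qed.

Lemma sqrt_comm : N * a = a * N.
Proof.
have [c [r [_ _ aS]]] := exists_spectral_chain a_im.
exact: principal_sqrt_comm a_im aS.
Qed.

Lemma sign_sqr : sign a ^+ 2 = 1.
Proof.
have [c [r [_ _ aS]]] := exists_spectral_chain a_im.
exact: sign_chain_sqr a_im aS.
Qed.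

Lemma sign_sqrt : a = sign a * N.
Proof. by rewrite /sign -/N divrK // sqrt_unit. Qed.

(** In one direction [a] is its own principal root; in the other [a = N]. *)
Lemma sign_eq1 : spectrum a `<=` right_half_plane <-> sign a = 1.
Proof.
split=> [aH|S1]; last by rewrite sign_sqrt S1 mul1r; exact: sqrt_half_plane.
by rewrite (signE (erefl (a * a)) aH) divrr // half_plane_unit.
Qed.

Lemma sign_conj v : v \is a GRing.unit -> sign (v^-1 * a * v) = v^-1 * sign a * v.
Proof.
move=> uv; have conjM x y : (v^-1 * x * v) * (v^-1 * y * v) = v^-1 * (x * y) * v.
  by rewrite !mulrA -[_ * v * v^-1]mulrA divrr // mulr1.
rewrite (signE (y := v^-1 * N * v)); last first.
- by rewrite spectrum_conj //; exact: sqrt_half_plane.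
- by rewrite conjM sqrt_sqr !expr2 conjM.
have uN := sqrt_unit.
have [_ ->] : v^-1 * N * v \is a GRing.unit /\
    (v^-1 * N * v)^-1 = v^-1 * N^-1 * v.
  by apply: invrP; rewrite conjM ?divrr ?mulVr // mulr1 mulVr.
by rewrite conjM.
Qed.

Lemma signZ (c : R) : c != 0 -> sign (c%:C *: a) = (c / `|c|)%:C *: sign a.
Proof.
move=> c0; have n0 : 0 < `|c| by rewrite normr_gt0.
have n0C : `|c|%:C != 0 by rewrite (inj_eq (@complexI R)) gt_eqF.
rewrite (signE (y := `|c|%:C *: N)); last first.
- by apply: spectrumZ => //; exact: sqrt_half_plane.
- rewrite -scalerAl -scalerAr sqrt_sqr !expr2 -scalerAl -scalerAr !scalerA.
  by rewrite -!rmorphM /= -!expr2 real_normK ?num_real.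
have uN := sqrt_unit.
have [_ ->] : `|c|%:C *: N \is a GRing.unit /\
    (`|c|%:C *: N)^-1 = `|c|%:C^-1 *: N^-1.
  by apply: invrP; rewrite -scalerAl -scalerAr scalerA ?divrr ?mulVr // ?divff ?mulVf ?scale1r.
by rewrite -scalerAl -scalerAr scalerA rmorphM /= fmorphV.
Qed.

Lemma signV : sign a^-1 = sign a.
Proof.
have uN := sqrt_unit; have ua : a \is a GRing.unit.
  apply: spectrum_unit => a0.
  by have := spectrum_Re_neq0 a_im a0; rewrite eqxx.
rewrite (signE (y := N^-1)); last first.
- exact/spectrumV/sqrt_half_plane.
- by rewrite -invrM // sqrt_sqr exprVn.
(* Since [N = a ^+ 2 * N^-1], one has [a^-1 * N = a * N^-1]. *)
rewrite invrK /sign -/N -[in LHS](mulrK uN N) sqrt_sqr expr2 -mulrA mulKr //.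
Qed.

End spectrum_off_axis.

(** The sign of a scalar is taken in the algebra [R[i]^o], where the principal root of the square is
    the absolute value. *)
Lemma scalar_sign (c : R) : c != 0 -> sign (c%:C : R[i]^o) = (c / `|c|)%:C.
Proof.
move=> c0; have n0 : 0 < `|c| by rewrite normr_gt0.
have cc : (`|c|%:C : R[i]^o) * `|c|%:C = (c%:C : R[i]^o) ^+ 2.
  by rewrite -rmorphM -expr2 real_normK ?num_real // rmorphXn.
have cH : spectrum (`|c|%:C : R[i]^o) `<=` right_half_plane.
  move=> z; have [->|zc] := eqVneq z `|c|%:C; first by [].
  by move/scalar_spectrum: zc.
by rewrite /sign (principal_sqrtE cc cH) rmorphM /= fmorphV.
Qed.

End sign_properties.

(** * Adjoints *)

Section hilbert.
Variables (R : realType) (H : hilbertType R).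
Implicit Types (x y z : H) (k : R[i]) (r : R).

Definition hnorm x : R := complex.Re `|x|.

Lemma hnormE x : `|x| = (hnorm x)%:C.
Proof. by rewrite /hnorm RRe_real // ger0_real. Qed.

Lemma hnorm_ge0 x : 0 <= hnorm x.
Proof. by rewrite -lecR -hnormE; exact: normr_ge0. Qed.

Lemma hnormD x y : hnorm (x + y) <= hnorm x + hnorm y.
Proof. by rewrite -lecR rmorphD /= -!hnormE ler_normD. Qed.

Lemma hnormN x : hnorm (- x) = hnorm x.
Proof. by rewrite /hnorm normrN. Qed.

Lemma hnorm_eq0 x : hnorm x = 0 -> x = 0.
Proof. by move=> x0; apply/eqP; rewrite -normr_eq0 hnormE x0. Qed.

Lemma innerDr x y z : inner x (y + z) = inner x y + inner x z.
Proof. by rewrite innerC innerDl rmorphD /= -!innerC. Qed.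

Lemma innerZr k x y : inner x (k *: y) = k^* * inner x y.
Proof. by rewrite innerC innerZl rmorphM /= -innerC. Qed.

Lemma inner_inj y z : (forall x, inner x y = inner x z) -> y = z.
Proof.
move=> yz; apply/subr0_eq/hnorm_eq0/eqP; rewrite -sqrf_eq0.
have : inner (y - z) (y - z) = 0.
  have := innerDr (y - z) (y - z) z; rewrite subrK yz => /esym/eqP.
  by rewrite -subr_eq0 addrK => /eqP.
by rewrite inner_norm hnormE -rmorphXn /= => /complexI ->.
Qed.

Definition rinner x y : R := complex.Re (inner x y).

Lemma rinnerC x y : rinner x y = rinner y x.
Proof. by rewrite /rinner innerC; case: inner. Qed.

Lemma rinnerDl x y z : rinner (x + y) z = rinner x z + rinner y z.
Proof. by rewrite /rinner innerDl; case: inner => ? ?; case: inner. Qed.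

Lemma rinnerZl r x y : rinner (r%:C *: x) y = r * rinner x y.
Proof. by rewrite /rinner innerZl; case: inner => ? ? /=; rewrite mul0r subr0. Qed.

Lemma rinnerDr x y z : rinner x (y + z) = rinner x y + rinner x z.
Proof. by rewrite rinnerC rinnerDl !(rinnerC _ x). Qed.

Lemma rinnerZr r x y : rinner x (r%:C *: y) = r * rinner x y.
Proof. by rewrite rinnerC rinnerZl rinnerC. Qed.

Lemma rinner_norm x : rinner x x = hnorm x ^+ 2.
Proof. by rewrite /rinner inner_norm hnormE -rmorphXn. Qed.

Lemma hnormD_sqr x y : hnorm (x + y) ^+ 2 = hnorm x ^+ 2 + 2 * rinner x y + hnorm y ^+ 2.
Proof.
rewrite -!rinner_norm rinnerDl !rinnerDr (rinnerC y x); ring.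
Qed.

(** Cauchy-Schwarz, obtained by squaring the triangle inequality that the norm already satisfies. *)
Lemma rinner_le x y : rinner x y <= hnorm x * hnorm y.
Proof.
have := hnormD_sqr x y; have := hnormD x y.
have := hnorm_ge0 x; have := hnorm_ge0 y; have := hnorm_ge0 (x + y).
nra.
Qed.

(** * Riesz representation by minimization *)

Section representation.
Variables (phi : H -> R[i]) (M : R).
Hypothesis phiD : forall x y, phi (x + y) = phi x + phi y.
Hypothesis phiZ : forall k x, phi (k *: x) = k * phi x.
Hypothesis phiM : forall x, complex.Re (phi x) <= M * hnorm x.

Let f x := complex.Re (phi x).
Let fD x y : f (x + y) = f x + f y.
Proof. by rewrite /f phiD; case: (phi x) (phi y) => ? ? [? ?]. Qed.
Let fZ r x : f (r%:C *: x) = r * f x.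
Proof. by rewrite /f phiZ; case: (phi x) => ? ? /=; rewrite mul0r subr0. Qed.

(** If [z] represents [f], then [q x = |x - z|^2 - |z|^2], so the representing vector is found as
    the minimizer of [q]. *)
Let q x := hnorm x ^+ 2 - 2 * f x.

Let q_ge x : - M ^+ 2 <= q x.
Proof.
have := phiM x; rewrite /q -/(f x) => h.
by have := sqr_ge0 (hnorm x - M); rewrite sqrrB; move: h; lra.
Qed.

Let q_inf : has_inf (range q).
Proof. by split; [exists (q 0), 0 | exists (- M ^+ 2) => _ [x _ <-]]. Qed.

Let m := inf (range q).

Let m_le x : m <= q x.
Proof. by apply: ge_inf; [exact: q_inf.2 | exists x]. Qed.

Let near_inf (n : nat) : exists x, q x < m + n.+1%:R^-1.
Proof.
have n0 : 0 < n.+1%:R^-1 :> R by rewrite invr_gt0.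
by have [_ [x _ <-] h] := inf_adherent n0 q_inf; exists x.
Qed.

(** The parallelogram law with [m <= q] at the midpoint, where the linear parts cancel; it makes
    minimizing sequences Cauchy. *)
Let par x y : hnorm (x - y) ^+ 2 <= 2 * (q x - m) + 2 * (q y - m).
Proof.
have := m_le ((2^-1)%:C *: (x + y)); rewrite /q fZ fD -rinner_norm.
rewrite rinnerZl rinnerZr rinner_norm !hnormD_sqr hnormN.
have -> : rinner x (- y) = - rinner x y.
  by rewrite -scaleN1r -(rmorphN1 (real_complex R)) rinnerZr mulN1r.
by lra.
Qed.

Let q_shift x y r : q (x + r%:C *: y) =
  q x + 2 * r * (rinner x y - f y) + r ^+ 2 * hnorm y ^+ 2.
Proof.
rewrite /q hnormD_sqr fD fZ -[hnorm (_ *: _) ^+ 2]rinner_norm rinnerZl !rinnerZr.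
rewrite rinner_norm; ring.
Qed.

Lemma riesz_representation : exists z, forall x, phi x = inner x z.
Proof.
have [u uP] := choice near_inf.
have cvg0 (e : R) : 0 < e -> exists N, forall n, (N <= n)%N -> n.+1%:R^-1 < e.
  move=> e0; exists (Num.trunc e^-1) => n Nn.
  rewrite -[e]invrK ltf_pV2 ?posrE ?invr_gt0 //.
  by rewrite (lt_le_trans (truncnS_gt _)) // ler_nat.
have [|z zP] := @cauchy_seq_cvg _ H u.
  move=> e e0; have eE : e = (complex.Re e)%:C by rewrite RRe_real // gtr0_real.
  have re0 : 0 < complex.Re e by rewrite -ltcR -eE.
  have [|N hN] := cvg0 (complex.Re e ^+ 2 / 4).
    by rewrite divr_gt0 // exprn_gt0.
  exists N => j n Nj Nn; rewrite hnormE eE ltcR.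
  rewrite -(ltr_pXn2r (n := 2)) ?nnegrE ?hnorm_ge0 ?(ltW re0) //.
  apply: le_lt_trans (par _ _) _.
  move: (hN j Nj) (hN n Nn) (uP j) (uP n).
  move: (q (u j)) (q (u n)) (j.+1%:R^-1 : R) (n.+1%:R^-1 : R) (complex.Re e ^+ 2).
  move=> a b c d e2; lra.
have zP' e : 0 < e -> exists N, forall n, (N <= n)%N -> hnorm (z - u n) < e.
  move=> e0; have e0C : 0 < e%:C by rewrite ltcR.
  have [N hN] := zP _ e0C; exists N => n /hN.
  by rewrite distrC hnormE ltcR.
have real_part x : rinner z x = f x.
  apply/subr0_eq/eqP; rewrite -normr_le0; apply/ler_addgt0Pr => e e0; rewrite add0r.
  have x0 := hnorm_ge0 x; have x1 : 0 < hnorm x + 1 by lra.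
  pose K := hnorm x ^+ 2 + 1; have K0 : 0 < K by rewrite ltr_wpDl ?sqr_ge0.
  have e2 : 0 < e / 2 by lra.
  have [N hN] := zP' (e / 2 / (hnorm x + 1)) (divr_gt0 e2 x1).
  have [|N' hN'] := cvg0 ((e / 2) ^+ 2 / K); first by rewrite divr_gt0 // exprn_gt0.
  pose n := maxn N N'; pose d := rinner (u n) x - f x.
  have hd : `|d| < e / 2.
    rewrite -(ltr_pXn2r (n := 2)) ?nnegrE ?normr_ge0 ?(ltW e2) // real_normK ?num_real //.
    have := hN' n (leq_maxr _ _); rewrite ltr_pdivlMr // => h; apply: le_lt_trans h.
    (* Along [x] the first variation of [q] at [u n] is [2 * d]. The step [- d / K] lowers [q] by at
       least [d ^+ 2 / K], while [u n] is within [1 / (n + 1)] of the infimum. *)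
    have := m_le (u n + (- d / K)%:C *: x); rewrite q_shift -/d => h.
    have := uP n => h'.
    have dK : d ^+ 2 / K <= n.+1%:R^-1.
      have KK : hnorm x ^+ 2 / K <= 1 by rewrite ler_pdivrMr // mul1r /K; lra.
      have d2 : 0 <= d ^+ 2 / K by rewrite divr_ge0 ?sqr_ge0 // ltW.
      have := ler_wpM2l d2 KK; rewrite mulr1 => h''.
      have e1 : 2 * (- d / K) * d = - (2 * (d ^+ 2 / K)) by ring.
      have e3 : (- d / K) ^+ 2 * hnorm x ^+ 2 = d ^+ 2 / K * (hnorm x ^+ 2 / K).
        by field; rewrite gt_eqF.
      rewrite e1 e3 in h; move: h h' h''; move: (q (u n)) (n.+1%:R^-1 : R).
      move=> p p'; move: (d ^+ 2 / K * (hnorm x ^+ 2 / K)) (d ^+ 2 / K) => t' t; lra.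
    by rewrite -ler_pdivrMr.
  have -> : rinner z x - f x = d + rinner (z - u n) x.
    by rewrite /d -[in LHS](subrK (u n) z) rinnerDl; ring.
  have hz : `|rinner (z - u n) x| <= hnorm (z - u n) * hnorm x.
    rewrite ler_norml rinner_le andbT lerNl.
    have := rinner_le (- (z - u n)) x; rewrite hnormN.
    by rewrite -scaleN1r -(rmorphN1 (real_complex R)) rinnerZl mulN1r.
  have := hN n (leq_maxl _ _); rewrite ltr_pdivlMr //.
  have := hnorm_ge0 (z - u n); have := ler_normD d (rinner (z - u n) x).
  by move: hd hz; lra.
(* The imaginary part is recovered from the real part at ['i *: x]. *)
exists z => x; have h1 := real_part x; have h2 := real_part ('i *: x).
move: h1 h2; rewrite !(rinnerC z) /f /rinner innerZl phiZ.
case: (inner x z) (phi x) => p s [p' s'] /= -> h.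
by congr (_ +i* _); move: h; rewrite !mul0r !mul1r; lra.
Qed.

End representation.

(** * Existence of adjoints and their signs *)

Implicit Types S T : bop H.

Lemma bop_bounded T : exists2 M, 0 <= M & forall x, hnorm (T x) <= M * hnorm x.
Proof.
have [_ [M TM]] := bopP T; exists `|M| => // x.
apply: (@le_trans _ _ (M * hnorm x)); last by rewrite ler_wpM2r ?hnorm_ge0 // ler_norm.
by rewrite -lecR rmorphM /= -!hnormE.
Qed.

Lemma bop_linear T k x y : T (k *: x + y) = k *: T x + T y.
Proof. by have [+ _] := bopP T; apply. Qed.

Lemma adjoint_exists T : exists S, forall x y, inner (T x) y = inner x (S y).
Proof.
have [M M0 TM] := bop_bounded T.
have TD x y : T (x + y) = T x + T y.
  by have := bop_linear T 1 x y; rewrite !scale1r.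
have T0 : T 0 = 0 by apply: (addrI (T 0)); rewrite -TD !addr0.
have TZ k x : T (k *: x) = k *: T x.
  by have := bop_linear T k x 0; rewrite !addr0 T0 addr0.
have rep y : exists z, forall x, inner (T x) y = inner x z.
  apply: (riesz_representation (M := M * hnorm y)) => [x x'|k x|x].
  - by rewrite TD innerDl.
  - by rewrite TZ innerZl.
  - rewrite (le_trans (rinner_le _ _)) // mulrAC ler_wpM2r ?hnorm_ge0 //.
have [S SP] := choice rep.
suff Sb : bounded_op S by exists (Bop Sb) => x y; exact: SP.
split.
  move=> k x y; apply: inner_inj => z.
  by rewrite -SP !innerDr !innerZr !SP.
exists M => y; rewrite !hnormE -rmorphM lecR.
have [S0|S0] := eqVneq (hnorm (S y)) 0; first by rewrite S0 mulr_ge0 ?hnorm_ge0.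
have Sy0 : 0 < hnorm (S y) by rewrite lt_neqAle eq_sym S0 hnorm_ge0.
(* [|S y|^2] is the real part of the inner product of [T (S y)] and [y], hence at most
   [M |S y| |y|]. *)
rewrite -(ler_pM2l Sy0) -expr2 -rinner_norm /rinner -SP.
rewrite (le_trans (rinner_le _ _)) // mulrA ler_wpM2r ?hnorm_ge0 //.
by rewrite mulrC TM.
Qed.

Lemma adjointP T x y : inner (T x) y = inner x (adjoint T y).
Proof.
have [S SP] := adjoint_exists T.
by rewrite /adjoint; case: xgetP => [S' _ /=|/(_ S)]; [exact | case].
Qed.

Lemma adjoint_eq T S : (forall x y, inner (T x) y = inner x (S y)) -> adjoint T = S.
Proof.
move=> SP; apply: bop_ext => y; apply: inner_inj => x.
by rewrite -adjointP SP.
Qed.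

Lemma adjointM S T : adjoint (S * T) = adjoint T * adjoint S.
Proof. by apply: adjoint_eq => x y /=; rewrite adjointP adjointP. Qed.

Lemma adjoint1 : adjoint (1 : bop H) = 1.
Proof. exact: adjoint_eq. Qed.

Lemma bop_scalarBE k T x : (k%:A - T) x = k *: x + (-1) *: T x.
Proof. by []. Qed.

Lemma adjoint_scalarB k T : adjoint (k^*%:A - T) = k%:A - adjoint T.
Proof.
apply: adjoint_eq => x y; rewrite !bop_scalarBE.
rewrite innerDl innerDr (innerZl k^* x) (innerZr k x) (innerZl _ (T x)) (innerZr _ x).
by rewrite rmorphN1 adjointP.
Qed.

Lemma adjoint_unit T : T \is a GRing.unit ->
  adjoint T \is a GRing.unit /\ (adjoint T)^-1 = adjoint T^-1.
Proof.
by move=> uT; apply: invrP; rewrite -adjointM ?mulVr ?divrr // adjoint1.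
Qed.

(** Taking adjoints conjugates the spectrum, and the half plane is stable under conjugation. *)
Lemma adjoint_half_plane T : spectrum T `<=` right_half_plane ->
  spectrum (adjoint T) `<=` right_half_plane.
Proof.
move=> TH z zT; have : right_half_plane z^*.
  apply: TH; apply: contraT; rewrite negbK => /adjoint_unit[+ _].
  by rewrite adjoint_scalarB => u; case/negP: zT.
by rewrite /right_half_plane; case: z {zT}.
Qed.

Lemma sign_adjoint T : spectrum T `&` imaginary_axis = set0 ->
  sign (adjoint T) = adjoint (sign T).
Proof.
move=> T_im; set N := principal_sqrt (T ^+ 2).
have NN : N * N = T ^+ 2 := sqrt_sqr T_im.
have NH := sqrt_half_plane T_im.
have uN : N \is a GRing.unit := half_plane_unit NH.
rewrite (@signE _ _ _ (adjoint N)); last first.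
- exact: adjoint_half_plane.
- by rewrite expr2 -!adjointM NN expr2.
have [_ ->] := adjoint_unit uN; rewrite -adjointM; congr adjoint.
(* The adjoint reverses products, so [N^-1 * T] has to be identified with [T * N^-1]. *)
have NT : N * T = T * N.
  by rewrite (sqrt_comm T_im).
rewrite /sign -/N; apply: (mulrI uN); rewrite mulrA divrr // mul1r.
by rewrite mulrA NT mulrK.
Qed.

Lemma selfadjoint_sign T : spectrum T `&` imaginary_axis = set0 ->
  selfadjoint T -> symmetry (sign T).
Proof.
move=> T_im Tsa; have Ssa : selfadjoint (sign T).
  by rewrite /selfadjoint -sign_adjoint // Tsa.
have SS : sign T * sign T = 1 := sign_sqr T_im.
by split=> //; split; rewrite Ssa.
Qed.

End hilbert.

Theorem proposition3p1 (R : realType) :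
  (forall (A : banachAlgType R) (a : A),
    spectrum a `&` imaginary_axis = set0 ->
    let S := sign a in
    let N := principal_sqrt (a ^+ 2) in
    let Ep := 2^-1 *: (1 + S) in
    let Em := 2^-1 *: (1 - S) in
    (* (1) *) S ^+ 2 = 1 /\
    (* (2) *) bicommutant a S /\
    (* (4) *) ((Ep * Ep = Ep /\ Em * Em = Em /\ Ep + Em = 1) /\
               (S * Ep = Ep /\ S * Em = - Em /\ S = Ep - Em) /\
               is_spectral_idempotent a Ep) /\
    (* (5) *) (spectrum a `<=` right_half_plane <-> S = 1) /\
    (* (6) *) (forall v : A, v \is a GRing.unit ->
                 sign (v^-1 * a * v) = v^-1 * S * v) /\
    (* (7) *) a = S * N /\
    (* (8) *) (forall c : R, c != 0 ->
                 sign (c%:C *: a) = (sign (c%:C : R[i]^o) : R[i]) *: S) /\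
    (* (9) *) sign a^-1 = S) /\
  (* (3) *)
  (forall (H : hilbertType R) (a : bop H),
    spectrum a `&` imaginary_axis = set0 ->
    (selfadjoint a -> symmetry (sign a)) /\
    sign (adjoint a) = adjoint (sign a)).
Proof.
split=> [A a a_im S N Ep Em|H a a_im]; last first.
  by split; [exact: selfadjoint_sign | exact: sign_adjoint].
(* The algebraic identities for [Ep] and [Em] follow from this one; only the identification with the
   Riesz idempotent goes back to contours. *)
have SS : S * S = 1 := sign_sqr a_im.
have half (x : A) : 2^-1 *: (x + x) = x.
  have -> : x + x = 2%:R *: x by rewrite scaler_nat mulr2n.
  by rewrite scalerA mulVf ?scale1r // pnatr_eq0.
have EE : Ep + Em = 1 by rewrite /Ep /Em -scalerDr addrACA subrr addr0 half.
have SEp : S * Ep = Ep by rewrite /Ep -scalerAr mulrDr mulr1 SS addrC.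
have SEm : S * Em = - Em by rewrite /Em -scalerAr mulrBr mulr1 SS -scalerN opprB.
have Sdec : S = Ep - Em by rewrite -[S]mulr1 -EE mulrDr SEp SEm.
have EpEp : Ep * Ep = Ep.
  by rewrite {1}/Ep -scalerAl mulrDl mul1r SEp half.
have EmEm : Em * Em = Em.
  by rewrite {1}/Em -scalerAl mulrBl mul1r SEm opprK half.
have [c [r [_ _ aS]]] := exists_spectral_chain a_im.
split; first exact: sign_sqr.
split; first exact: sign_chain_bicommutant a_im aS.
split.
  split=> //; split=> //.
  rewrite /Ep /S (sign_chain_proj a_im aS); exact: riesz_spectral_idempotent.
split; first exact: sign_eq1.
split; first exact: sign_conj.
split; first exact: sign_sqrt.
split; last exact: signV.
by move=> c' c0; rewrite scalar_sign // signZ.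
Qed.
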